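(* Let $A$ and $A'$ be disjoint finite sets with a bijection $a\mapsto a'$ from $A$ to $A'$. Let $$G=\langle A\cup A'\mid u=u'\rangle,$$ where $u\in F_A$ and $u'\in F_{A'}$ is obtained from $u$ by replacing each letter $a$ with $a'$. Let $X\subseteq F_A$ be a finite subset such that $1\notin X$, and let $X'\subseteq F_{A'}$ be the corresponding set obtained from $X$ by replacing each letter $a$ with $a'$. If the submonoid of $F_A$ generated by $X$ is graded, then the submonoid of $G$ generated by $X\cup X'$ is graded with linear distortion function. In particular, membership in the submonoid of $G$ generated by $X\cup X'$ is decidable.
   Context: $F_A$ denotes the free group on $A$. For a monoid $M$ generated by a finite set $S$ and $m\in M$, $|m|_S$ is the least $k$ such that $m=s_1\cdots s_k$ with $s_i\in S$. A monoid $M$ is graded if it admits a finite generating set $S$ such that every element of $M$ can be expressed as a word over $S$ in only finitely many ways. If $M$ is a submonoid, generated by a finite set $S$, of a monoid $G$ generated by a finite set $X_0$ (for a group, a finite monoid generating set), a distortion function for $M$ in $G$ with respect to $S$ and $X_0$ is any non-decreasing function $\delta:\mathbb{N}\to\mathbb{N}$ such that $|g|_S\leq\delta(|g|_{X_0})$ for all $g\in M$. It is linear if there are constants $\alpha,\beta>0$ with $\delta(n)\leq\alpha n+\beta$ for all $n\in\mathbb{N}$; whether a linear distortion function exists does not depend on the choice of the finite generating sets. For a group $G$ generated by a finite set $B$ and a finitely generated submonoid $M\leq G$, membership in $M$ is decidable if there is an algorithm that takes any word over $B\cup B^{-1}$ and decides whether the element of $G$ it represents belongs to $M$. *)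

(* Defs.v *)
From HB Require Import structures.
From mathcomp Require Import all_boot.
From mathcomp Require Import generic_quotient finmap.
From mathcomp Require Import boolp classical_sets cardinality.

Set Implicit Arguments.
Unset Strict Implicit.
Unset Printing Implicit Defensive.

Local Open Scope group_scope.
Local Open Scope quotient_scope.
Local Open Scope fset_scope.
Local Open Scope classical_set_scope.

(* The letter (t, false) stands for t and (t, true) for its inverse. *)
Definition word (T : Type) := seq (T * bool).

Definition word_eval (T : Type) (G : groupType) (h : T -> G) (w : word T) : G :=
  \prod_(x <- w) (if x.2 then (h x.1)^-1 else h x.1).

Definition inv_word (T : Type) (w : word T) : word T :=
  rev [seq (x.1, ~~ x.2) | x <- w].

Inductive word_cong (T : Type) (R : word T -> word T -> Prop) :
    word T -> word T -> Prop :=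
| word_cong_refl w : word_cong R w w
| word_cong_sym w1 w2 : word_cong R w1 w2 -> word_cong R w2 w1
| word_cong_trans w1 w2 w3 :
    word_cong R w1 w2 -> word_cong R w2 w3 -> word_cong R w1 w3
| word_cong_cat w1 w2 v1 v2 :
    word_cong R w1 w2 -> word_cong R v1 v2 -> word_cong R (w1 ++ v1) (w2 ++ v2)
| word_cong_cancel t b : word_cong R [:: (t, b); (t, ~~ b)] [::]
| word_cong_rel w1 w2 : R w1 w2 -> word_cong R w1 w2.

Section PresentedGroup.
Variables (T : choiceType) (R : word T -> word T -> Prop).

Definition word_congb : rel (seq (T * bool)) :=
  fun w1 w2 => `[< word_cong R w1 w2 >].

Lemma word_congb_refl : reflexive word_congb.
Proof. by move=> w; apply/asboolP; exact: word_cong_refl. Qed.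

Lemma word_congb_sym : symmetric word_congb.
Proof.
by move=> w1 w2; apply/asboolP/asboolP => ?; exact: word_cong_sym.
Qed.

Lemma word_congb_trans : transitive word_congb.
Proof.
move=> w2 w1 w3 /asboolP h1 /asboolP h2; apply/asboolP.
exact: word_cong_trans h1 h2.
Qed.

Canonical word_congb_equiv :=
  EquivRel word_congb word_congb_refl word_congb_sym word_congb_trans.

(* The group <T | w1 = w2 for all w1, w2 such that R w1 w2>. *)
Definition presented := {eq_quot word_congb}.
HB.instance Definition _ := Choice.on presented.
HB.instance Definition _ := EqQuotient.on presented.

Definition pres_class (w : word T) : presented := \pi_presented w.

Lemma pres_classP w1 w2 : pres_class w1 = pres_class w2 <-> word_cong R w1 w2.
Proof. by split=> [/eqmodP/asboolP|h]; [|apply/eqmodP/asboolP]. Qed.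

Lemma pres_classK x : pres_class (repr x) = x.
Proof. exact: reprK. Qed.

Lemma word_cong_repr w : word_cong R (repr (pres_class w)) w.
Proof. by apply/pres_classP; rewrite pres_classK. Qed.

Lemma word_cong_mulV w : word_cong R (w ++ inv_word w) [::].
Proof.
elim: w => [|[t b] w IHw]; first exact: word_cong_refl.
have -> : ((t, b) :: w) ++ inv_word ((t, b) :: w) =
    [:: (t, b)] ++ (w ++ inv_word w) ++ [:: (t, ~~ b)].
  by rewrite /inv_word /= rev_cons -cats1 !catA.
apply: word_cong_trans (word_cong_cancel R t b).
apply: (@word_cong_cat _ _ [:: (t, b)] [:: (t, b)]).
  exact: word_cong_refl.
by apply: (@word_cong_cat _ _ _ [::]) => //; exact: word_cong_refl.
Qed.

Lemma inv_wordK : involutive (@inv_word T).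
Proof.
move=> w; rewrite /inv_word map_rev revK -map_comp map_id_in // => -[t b] _ /=.
by rewrite negbK.
Qed.

Lemma word_cong_Vmul w : word_cong R (inv_word w ++ w) [::].
Proof. by rewrite -{2}[w]inv_wordK; exact: word_cong_mulV. Qed.

Lemma word_cong_inv w1 w2 :
  word_cong R w1 w2 -> word_cong R (inv_word w1) (inv_word w2).
Proof.
move=> h; have refl := @word_cong_refl T R.
apply: (@word_cong_trans _ _ _ (inv_word w1 ++ (w2 ++ inv_word w2))).
  rewrite -{1}[inv_word w1]cats0; apply: word_cong_cat => //.
  exact/word_cong_sym/word_cong_mulV.
rewrite catA -{2}[inv_word w2]cat0s; apply: word_cong_cat => //.
apply: word_cong_trans (word_cong_Vmul w1); apply: word_cong_cat => //.
exact: word_cong_sym.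
Qed.

Definition pres_mul (x y : presented) := pres_class (repr x ++ repr y).
Definition pres_one := pres_class [::].
Definition pres_inv (x : presented) := pres_class (inv_word (repr x)).

Lemma pres_mulE w1 w2 :
  pres_mul (pres_class w1) (pres_class w2) = pres_class (w1 ++ w2).
Proof.
by apply/pres_classP; apply: word_cong_cat; exact: word_cong_repr.
Qed.

Lemma pres_invE w : pres_inv (pres_class w) = pres_class (inv_word w).
Proof. by apply/pres_classP/word_cong_inv/word_cong_repr. Qed.

Lemma pres_mulA : associative pres_mul.
Proof.
move=> x y z; rewrite -[x]pres_classK -[y]pres_classK -[z]pres_classK.
by rewrite !pres_mulE catA.
Qed.

Lemma pres_mul1 : left_id pres_one pres_mul.
Proof. by move=> x; rewrite -[x]pres_classK pres_mulE. Qed.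

Lemma pres_mulr1 : right_id pres_one pres_mul.
Proof. by move=> x; rewrite -[x]pres_classK pres_mulE cats0. Qed.

Lemma pres_mulV : left_inverse pres_one pres_inv pres_mul.
Proof.
move=> x; rewrite -[x]pres_classK pres_invE pres_mulE.
exact/pres_classP/word_cong_Vmul.
Qed.

Lemma pres_mulrV : right_inverse pres_one pres_inv pres_mul.
Proof.
move=> x; rewrite -[x]pres_classK pres_invE pres_mulE.
exact/pres_classP/word_cong_mulV.
Qed.

HB.instance Definition _ := isGroup.Build presented
  pres_mulA pres_mul1 pres_mulr1 pres_mulV pres_mulrV.

Definition pres_gen (t : T) : presented := pres_class [:: (t, false)].

End PresentedGroup.

Arguments pres_class {T} R w.
Arguments pres_gen {T} R t.

Lemma word_eval_pres_gen (T : choiceType) (R : word T -> word T -> Prop) w :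
  word_eval (pres_gen R) w = pres_class R w.
Proof.
rewrite /word_eval; elim: w => [|[t b] w IHw]; first by rewrite big_nil.
rewrite big_cons IHw /=.
have -> : (if b then (pres_gen R t)^-1 else pres_gen R t)
          = pres_class R [:: (t, b)] by case: b; rewrite //= [_^-1]pres_invE.
by rewrite [LHS]pres_mulE.
Qed.

Definition no_relation (T : Type) (w1 w2 : word T) := False.

Definition free_group (T : choiceType) := presented (@no_relation T).
HB.instance Definition _ (T : choiceType) := Group.on (free_group T).

Definition free_class (T : choiceType) (w : word T) : free_group T :=
  pres_class (@no_relation T) w.
Definition free_gen (T : choiceType) (t : T) : free_group T :=
  free_class [:: (t, false)].

Definition free_lift (T : choiceType) (G : groupType) (h : T -> G)
  (x : free_group T) : G := word_eval h (repr x).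

Lemma free_lift_class (T : choiceType) (G : groupType) (h : T -> G) w :
  free_lift h (free_class w) = word_eval h w.
Proof.
have cat v1 v2 : word_eval h (v1 ++ v2) = word_eval h v1 * word_eval h v2.
  by rewrite /word_eval big_cat.
have eval w1 w2 : word_cong (@no_relation T) w1 w2 ->
    word_eval h w1 = word_eval h w2.
  elim=> // [v1 v2 v3 _ -> _ -> //|v1 v2 v3 v4 _ e _ e'|t b].
    by rewrite !cat e e'.
  rewrite /word_eval !big_cons big_nil mulg1 /=.
  by case: b; rewrite /= ?mulVg ?mulgV.
exact/eval/word_cong_repr.
Qed.

Definition free_map (T U : choiceType) (h : T -> U) :
  free_group T -> free_group U := free_lift (fun t => free_gen (h t)).

Section GradedMonoids.
Variable G : monoidType.

Definition words_for (S : {fset G}) (m : G) : set (seq G) :=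
  [set s | {subset s <= S} /\ \prod_(x <- s) x = m].

Definition submonoid_gen (S : {fset G}) : set G :=
  [set m | words_for S m !=set0].

Definition graded (M : set G) : Prop :=
  exists S : {fset G}, submonoid_gen S = M /\
    forall m, M m -> finite_set (words_for S m).

(* The value is 0 when m does not lie in the submonoid generated by S. *)
Definition gen_length (S : {fset G}) (m : G) : nat :=
  if pselect (exists k, `[< exists2 s, words_for S m s & size s = k >])
  is left h then ex_minn h else 0%N.

Definition distortion_function (M : set G) (S X0 : {fset G})
    (delta : nat -> nat) : Prop :=
  {homo delta : m n / (m <= n)%N} /\
  forall g, M g -> (gen_length S g <= delta (gen_length X0 g))%N.

End GradedMonoids.

Definition linearly_bounded (delta : nat -> nat) : Prop :=
  exists alpha beta : nat, [/\ (0 < alpha)%N, (0 < beta)%N &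
    forall n, (delta n <= alpha * n + beta)%N].

(* Kleene's total recursive functions.  Each of the last three rules
   characterises its function h by equations. *)
Inductive recursive : forall n, (n.-tuple nat -> nat) -> Prop :=
| recursive_zero : recursive (fun _ : 0.-tuple nat => 0%N)
| recursive_succ : recursive (fun v : 1.-tuple nat => (tnth v ord0).+1)
| recursive_proj n (i : 'I_n) : recursive (fun v : n.-tuple nat => tnth v i)
| recursive_comp m n (f : m.-tuple nat -> nat)
    (g : 'I_m -> n.-tuple nat -> nat) (h : n.-tuple nat -> nat) :
    recursive f -> (forall i, recursive (g i)) ->
    (forall v, h v = f [tuple g i v | i < m]) ->
    recursive h
| recursive_prim n (f : n.-tuple nat -> nat) (g : n.+2.-tuple nat -> nat)
    (h : n.+1.-tuple nat -> nat) :
    recursive f -> recursive g ->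
    (forall v : n.-tuple nat, h (cons_tuple 0%N v) = f v) ->
    (forall k (v : n.-tuple nat), h (cons_tuple k.+1 v) =
       g (cons_tuple k (cons_tuple (h (cons_tuple k v)) v))) ->
    recursive h
| recursive_mu n (f : n.+1.-tuple nat -> nat) (h : n.-tuple nat -> nat) :
    recursive f ->
    (forall v : n.-tuple nat, f (cons_tuple (h v) v) = 0%N /\
       forall k, (k < h v)%N -> f (cons_tuple k v) <> 0%N) ->
    recursive h.

Definition word_code (T : finType) (w : seq T) : nat :=
  CodeSeq.code [seq nat_of_ord (enum_rank x) | x <- w].

Definition decidable_language (T : finType) (L : seq T -> Prop) : Prop :=
  exists2 f : 1.-tuple nat -> nat, recursive f &
    forall w, f [tuple word_code w] = nat_of_bool `[< L w >].

(* The generators of G are given as a finite family b. *)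
Definition membership_decidable (B : finType) (G : groupType) (b : B -> G)
    (M : set G) : Prop :=
  decidable_language (fun w : seq (B * bool)%type => M (word_eval b w)).

Section Double.
Variables (A A' : finType) (phi : A -> A') (u : free_group A).

(* The disjoint sets A and A' are the two summands of A + A', and the primed copy
   of x : free_group A is free_map phi x.  Every word representing u is
   equated with every word representing u'. *)
Definition double_relation (w1 w2 : word (A + A')) : Prop :=
  free_class w1 = free_map inl u /\
  free_class w2 = free_map inr (free_map phi u).

Definition double_group := presented double_relation.
HB.instance Definition _ := Group.on double_group.

Definition double_gen (t : A + A') : double_group := pres_gen double_relation t.
Definition double_inl : free_group A -> double_group :=
  free_lift (fun a => double_gen (inl a)).
Definition double_inr : free_group A' -> double_group :=
  free_lift (fun a' => double_gen (inr a')).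

Definition double_gens (X : {fset free_group A}) : {fset double_group} :=
  ([fset double_inl x | x in X] `|`
   [fset double_inr (free_map phi x) | x in X])%fset.

End Double.

(* Main.v *)
Require Import Defs.
From mathcomp Require Import all_boot finmap boolp classical_sets cardinality.
From mathcomp Require Import zify.

(** Identifying each primed letter with its unprimed copy defines a retraction
    of the double G onto the free group F, which sends a product of k elements
    of X and X' to a product of k elements of X.  So everything reduces to one
    estimate in F: the number of factors of a product of elements of X is at
    most C (|x| + 1), where |x| is the reduced length of the product x
    ([linear_factorizations]).  Gradedness and linear distortion of M follow,
    because the retraction is Lipschitz ([bounded_pullback],
    [linear_distortion]).

    For the estimate, gradedness and 1 \notin X bound the number of factors for
    each single x ([graded_bounded]), hence uniformly on each ball.  If x starts
    with the letter a, then the partial products of a factorization of x form a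
    path with steps of length at most L := max |X| in the tree of reduced words,
    from 1 into the subtree of words starting with a; such a path has a vertex
    within distance L of a ([crossing]).  Cutting it there leaves a first piece
    whose product lies in a fixed ball, so that it has at most C factors, and a
    second piece whose product is, up to an error of length at most L on the
    left, the word x without its first letter.  Induction on the length finishes
    the proof, provided that the error is part of the induction statement.

    The estimate also makes membership in M a finite search: a word of length n
    lies in M if and only if it equals one of the products of at most C (n + 1)
    generators ([computable_membership]).  What remains is the word problem of
    G, which is F and its copy F' amalgamated along the subgroup <u>.  A word is
    read letter by letter into a stack of syllables taken alternately from F and
    F'; a syllable that lies in <u> belongs to both factors and is merged with
    its neighbour.  A word is trivial exactly when the stack collapses to a
    single trivial syllable ([run_stackP]), because an alternating product of at
    least two syllables, all of them outside <u> except possibly the first, is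
    not 1 ([alternating_prod_neq1]).  This is proved by van der Waerden's
    method: G acts on normal forms built from coset representatives of <u>.
    Recognizing the elements of <u> is again a search, bounded by the same
    estimate applied to the set {u} ([linear_cyclic_sub]).

    To turn this procedure into a recursive function, functions between
    countable types are called computable when a recursive function realizes
    them on codes; this class is closed under pairing, iteration, case
    distinction and folding over lists, and the procedure is built from these. *)

Set Implicit Arguments.
Unset Strict Implicit.
Unset Printing Implicit Defensive.

Local Notation pickle := choice.pickle.
Local Notation unpickle := choice.unpickle.
Local Notation pickleK := choice.pickleK.

(** * Recursive functions on codes of lists *)
Definition unary_rec (f : nat -> nat) : Prop :=
  recursive (fun v : 1.-tuple nat => f (tnth v ord0)).

Definition binary_rec (f : nat -> nat -> nat) : Prop :=
  recursive (fun v : 2.-tuple nat => f (tnth v ord0) (tnth v (lift ord0 ord0))).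

Lemma unary_rec_ext f g : f =1 g -> unary_rec f -> unary_rec g.
Proof. by move=> /funext ->. Qed.

Lemma recursive_unary n g (f : n.-tuple nat -> nat) :
  unary_rec g -> recursive f -> recursive (fun v => g (f v)).
Proof.
move=> hg hf; apply: (@recursive_comp 1 n _ (fun=> f) _ hg) => // v.
by rewrite tnth_mktuple.
Qed.

Lemma recursive_binary n g (f1 f2 : n.-tuple nat -> nat) :
  binary_rec g -> recursive f1 -> recursive f2 ->
  recursive (fun v => g (f1 v) (f2 v)).
Proof.
move=> hg h1 h2.
apply: (@recursive_comp 2 n _ (fun i => if i == ord0 then f1 else f2) _ hg).
  by move=> i; case: ifP.
by move=> v; rewrite !tnth_mktuple.
Qed.

Lemma recursive_const n c : recursive (fun _ : n.-tuple nat => c).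
Proof.
elim: c => [|c IHc].
  apply: (@recursive_comp 0 n _ (fun _ _ => 0) _ recursive_zero) => //.
  by case.
exact: (recursive_unary recursive_succ IHc).
Qed.

Lemma binary_rec_natrec g s : unary_rec g ->
  recursive (fun v : 3.-tuple nat => s (tnth v ord0)
     (tnth v (lift ord0 ord0)) (tnth v (lift ord0 (lift ord0 ord0)))) ->
  binary_rec (fun n m => nat_rect _ (g m) (fun k acc => s k acc m) n).
Proof.
move=> hg hs; refine (recursive_prim hg hs _ _).
  by move=> v; rewrite !(tnth_nth 0).
by move=> k v; rewrite !(tnth_nth 0).
Qed.

Lemma unary_rec_natrec c s : binary_rec s ->
  unary_rec (nat_rect _ c s).
Proof.
by move=> hs; refine (recursive_prim (recursive_const 0 c) hs _ _) => [v|k v];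
  rewrite !(tnth_nth 0).
Qed.

Lemma unary_rec_id : unary_rec id.
Proof. exact: recursive_proj. Qed.

Lemma binary_rec_iter s : unary_rec s -> binary_rec (fun n m => iter n s m).
Proof.
move=> hs.
refine (binary_rec_natrec (s := fun _ acc _ => s acc) unary_rec_id _).
exact: recursive_unary hs (recursive_proj _).
Qed.

Lemma unary_rec_comp f g : unary_rec f -> unary_rec g -> unary_rec (f \o g).
Proof. by move=> hf hg; exact: recursive_unary hf hg. Qed.

Lemma unary_rec_binary f g1 g2 : binary_rec f -> unary_rec g1 -> unary_rec g2 ->
  unary_rec (fun n => f (g1 n) (g2 n)).
Proof. by move=> hf h1 h2; exact: recursive_binary hf h1 h2. Qed.

Lemma unary_rec_const c : unary_rec (fun=> c).
Proof. exact: recursive_const. Qed.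

Lemma unary_rec_succ : unary_rec succn.
Proof. exact: recursive_succ. Qed.

Lemma binary_rec_fst : binary_rec (fun n _ => n).
Proof. exact: recursive_proj. Qed.

Lemma binary_rec_snd : binary_rec (fun _ n => n).
Proof. exact: recursive_proj. Qed.

Lemma binary_rec_unary f g : unary_rec f -> binary_rec g ->
  binary_rec (fun n m => f (g n m)).
Proof. by move=> hf hg; exact: recursive_unary hf hg. Qed.

Lemma binary_rec_comp f g1 g2 :
  binary_rec f -> binary_rec g1 -> binary_rec g2 ->
  binary_rec (fun n m => f (g1 n m) (g2 n m)).
Proof. by move=> hf h1 h2; exact: recursive_binary hf h1 h2. Qed.

Lemma binary_rec_add : binary_rec addn.
Proof.
rewrite (_ : addn = fun n m => iter n succn m); last first.
  by apply/funext => n; apply/funext => m; elim: n => //= n <-.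
exact: binary_rec_iter unary_rec_succ.
Qed.

Lemma unary_rec_pred : unary_rec predn.
Proof.
apply: unary_rec_ext (unary_rec_natrec 0 binary_rec_fst).
by case.
Qed.

Lemma binary_rec_sub : binary_rec subn.
Proof.
rewrite (_ : subn = fun m n => iter n predn m); last first.
  by apply/funext => n; apply/funext => m; elim: m => [|m IHm];
     rewrite ?subn0 //= subnS IHm.
exact: binary_rec_comp (binary_rec_iter unary_rec_pred)
         binary_rec_snd binary_rec_fst.
Qed.

Lemma unary_rec_nth c s : unary_rec (nth c s).
Proof.
elim: s => [|a s IHs].
  by apply: unary_rec_ext (unary_rec_const c) => -[].
apply: unary_rec_ext (unary_rec_natrec a (binary_rec_unary IHs binary_rec_fst)).
by case.
Qed.

Lemma unary_rec_double : unary_rec double.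
Proof.
apply: unary_rec_ext
  (unary_rec_binary binary_rec_add unary_rec_id unary_rec_id).
exact: addnn.
Qed.

Lemma unary_rec_eq0 : unary_rec (fun n => n == 0).
Proof.
by apply: unary_rec_ext (unary_rec_nth 0 [:: 1]) => -[|[|n]].
Qed.

Lemma unary_rec_odd : unary_rec odd.
Proof.
apply: unary_rec_ext
  (unary_rec_natrec 0 (binary_rec_unary unary_rec_eq0 binary_rec_snd)).
by elim=> //= n ->; case: odd.
Qed.

Lemma unary_rec_half : unary_rec half.
Proof.
apply: unary_rec_ext (unary_rec_natrec 0 (binary_rec_comp binary_rec_add
  (binary_rec_unary unary_rec_odd binary_rec_fst) binary_rec_snd)).
by elim=> //= n ->; rewrite uphalf_half.
Qed.

(** List operations on codes.  The code of n :: s is 2 ^ n * (2 * m + 1), where m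
    is the code of s, so that the head and the tail can be read off by repeated
    halving; 0 is the code of the empty list. *)
Definition cons_code n m := CodeSeq.code (n :: CodeSeq.decode m).

Lemma cons_codeE n m : cons_code n m = iter n double m.*2.+1.
Proof.
rewrite /cons_code /= CodeSeq.decodeK.
by elim: n => [|n IHn]; rewrite ?mul1n // expnS -mulnA IHn mul2n.
Qed.

Lemma binary_rec_cons : binary_rec cons_code.
Proof.
rewrite (_ : cons_code = fun n m => iter n double m.*2.+1); last first.
  by apply/funext => n; apply/funext => m; rewrite cons_codeE.
apply: (binary_rec_comp (binary_rec_iter unary_rec_double) binary_rec_fst).
exact: binary_rec_unary unary_rec_succ
         (binary_rec_unary unary_rec_double binary_rec_snd).
Qed.

Definition head_code m := head 0 (CodeSeq.decode m).
Definition tail_code m := CodeSeq.code (behead (CodeSeq.decode m)).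

Lemma code_nonnil m : 0 < m -> exists n k, m = cons_code n k.
Proof.
move=> m_gt0; case E: (CodeSeq.decode m) => [|n s].
  by rewrite -[m]CodeSeq.decodeK E in m_gt0.
exists n, (CodeSeq.code s); rewrite /cons_code CodeSeq.codeK -E.
by rewrite CodeSeq.decodeK.
Qed.

Lemma head_cons_code n m : head_code (cons_code n m) = n.
Proof. by rewrite /head_code CodeSeq.codeK. Qed.

Lemma tail_cons_code n m : tail_code (cons_code n m) = m.
Proof. by rewrite /tail_code CodeSeq.codeK /= CodeSeq.decodeK. Qed.

Lemma half_cons_code k n m : k <= n ->
  iter k half (cons_code n m) = cons_code (n - k) m.
Proof.
elim: k => [|k IHk] lt_kn; first by rewrite subn0.
rewrite iterS IHk 1?ltnW // !cons_codeE subnS -[n - k]prednK ?subn_gt0 //=.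
by rewrite doubleK.
Qed.

(** The head of a nonzero code is the least number of halvings that yields an
    odd number.  The search is made to stop at once on the code 0, since
    minimization has to terminate on every input. *)
Lemma unary_rec_head : unary_rec head_code.
Proof.
apply: (@recursive_mu 1 (fun v => (odd (iter (tnth v ord0) half
  (tnth v (lift ord0 ord0))) + (tnth v (lift ord0 ord0) == 0)) == 0)).
  apply: (recursive_unary unary_rec_eq0).
  apply: (recursive_binary binary_rec_add).
    apply: (recursive_unary unary_rec_odd).
    exact: (binary_rec_iter unary_rec_half).
  exact: (recursive_unary unary_rec_eq0 (recursive_proj _)).
move=> v.
pose test j m := (odd (iter j half m) + (m == 0)) == 0.
suff [h0 hlt] : test (head_code (tnth v ord0)) (tnth v ord0) = 0 :> nat /\
    forall j, j < head_code (tnth v ord0) -> test j (tnth v ord0) <> 0 :> nat.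
  split=> [|j lt_j]; first by move: h0; rewrite !(tnth_nth 0).
  by have := hlt j lt_j; rewrite !(tnth_nth 0).
have [->|/code_nonnil[n [k ->]]] := posnP (tnth v ord0); first by [].
have nz : (cons_code n k == 0) = false.
  by rewrite /cons_code /= muln_eq0 expn_eq0.
rewrite /test nz head_cons_code half_cons_code // subnn; split.
  by rewrite cons_codeE /= odd_double.
move=> j lt_jn; rewrite half_cons_code 1?ltnW //.
by rewrite cons_codeE -[n - j]prednK ?subn_gt0 //= odd_double.
Qed.

Lemma unary_rec_tail : unary_rec tail_code.
Proof.
have h : unary_rec (fun m => half (iter (head_code m) half m)).
  apply: (unary_rec_comp unary_rec_half).
  exact: (unary_rec_binary (binary_rec_iter unary_rec_half) unary_rec_head
    unary_rec_id).
apply: unary_rec_ext h => m.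
have [->//|/code_nonnil[n [k ->]]] := posnP m.
by rewrite head_cons_code tail_cons_code half_cons_code // subnn cons_codeE /=
  uphalf_double.
Qed.

(** * Computable functions between countable types *)

(** Realizability of f by a recursive function on codes.  Countable types include
    nat, finite types, pairs and lists, hence words, stacks and lists of words,
    and all functions can be treated as unary. *)
Definition computable (T U : countType) (f : T -> U) : Prop :=
  exists2 g, unary_rec g & forall x, g (pickle x) = pickle (f x).

Lemma computable_ext (T U : countType) (f g : T -> U) :
  f =1 g -> computable f -> computable g.
Proof. by move=> /funext ->. Qed.

Lemma computable_nat (f : nat -> nat) : computable f <-> unary_rec f.
Proof.
split=> [[g hg e]|hf]; last by exists f.
by apply: unary_rec_ext hg; exact: e.
Qed.

Lemma computable_id (T : countType) : computable (@id T).
Proof. by exists id => //; exact: unary_rec_id. Qed.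

Lemma computable_const (T U : countType) (y : U) : computable (fun _ : T => y).
Proof. by exists (fun=> pickle y) => //; exact: unary_rec_const. Qed.

Lemma computable_comp (T U V : countType) (f : U -> V) (g : T -> U) :
  computable f -> computable g -> computable (fun x => f (g x)).
Proof.
move=> [f' hf ef] [g' hg eg]; exists (f' \o g'); first exact: unary_rec_comp.
by move=> x /=; rewrite eg ef.
Qed.

Lemma computable_pickle (T U : countType) (f : T -> U) :
  computable f -> computable (fun x => pickle (f x)).
Proof. by case=> g hg eg; exists g. Qed.

Lemma pickle_pair (T U : countType) (x : T) (y : U) :
  pickle (x, y) = cons_code (pickle x) (cons_code (pickle y) 0).
Proof. by rewrite /cons_code CodeSeq.codeK. Qed.

Lemma pickle_cons (T : countType) (x : T) s :
  pickle (x :: s) = cons_code (pickle x) (pickle s).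
Proof. by rewrite /cons_code CodeSeq.codeK. Qed.

Lemma computable_pair (T U V : countType) (f : T -> U) (g : T -> V) :
  computable f -> computable g -> computable (fun x => (f x, g x)).
Proof.
move=> [f' hf ef] [g' hg eg].
exists (fun n => cons_code (f' n) (cons_code (g' n) 0)).
  apply: (unary_rec_binary binary_rec_cons hf).
  exact: (unary_rec_binary binary_rec_cons hg (unary_rec_const 0)).
by move=> x; rewrite ef eg pickle_pair.
Qed.

Lemma computable_fst (T U V : countType) (f : T -> U * V) :
  computable f -> computable (fun x => (f x).1).
Proof.
apply: (computable_comp (f := fst)).
exists head_code; first exact: unary_rec_head.
by case=> x y; rewrite pickle_pair head_cons_code.
Qed.

Lemma computable_snd (T U V : countType) (f : T -> U * V) :
  computable f -> computable (fun x => (f x).2).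
Proof.
apply: (computable_comp (f := snd)); exists (head_code \o tail_code).
  exact: unary_rec_comp unary_rec_head unary_rec_tail.
by case=> x y; rewrite pickle_pair /= tail_cons_code head_cons_code.
Qed.

Lemma computable_unary (T : countType) op (f : T -> nat) :
  unary_rec op -> computable f -> computable (fun x => op (f x)).
Proof. by move=> hop; apply: computable_comp; apply/computable_nat. Qed.

Lemma computable_binary (T : countType) op (f g : T -> nat) :
  binary_rec op -> computable f -> computable g ->
  computable (fun x => op (f x) (g x)).
Proof.
move=> hop [f' hf ef] [g' hg eg]; exists (fun n => op (f' n) (g' n)).
  exact: unary_rec_binary.
by move=> x; rewrite ef eg.
Qed.

(** The parameter x is carried along in the iterated state, so that closure under
    iteration of unary functions is enough. *)
Lemma computable_iter (T U : countType) (n : T -> nat) (s : T -> U -> U)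
    (a : T -> U) :
  computable n -> computable (fun p : T * U => s p.1 p.2) -> computable a ->
  computable (fun x => iter (n x) (s x) (a x)).
Proof.
move=> [n' hn en] [s' hs es] [a' ha ea].
pose pr i j := cons_code i (cons_code j 0).
have hpr f g :
    unary_rec f -> unary_rec g -> unary_rec (fun i => pr (f i) (g i)).
  move=> hf hg; apply: (unary_rec_binary binary_rec_cons hf).
  exact: (unary_rec_binary binary_rec_cons hg (unary_rec_const 0)).
exists (fun c => head_code (tail_code
   (iter (n' c) (fun p => pr (head_code p) (s' p)) (pr c (a' c))))).
  apply: (unary_rec_comp unary_rec_head).
  apply: (unary_rec_comp unary_rec_tail).
  apply: (unary_rec_binary (binary_rec_iter (hpr _ _ unary_rec_head hs)) hn).
  exact: hpr unary_rec_id ha.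
move=> x; rewrite en ea /=; set N := pickle (n x).
have -> : N = n x by [].
suff -> : iter (n x) (fun p => pr (head_code p) (s' p))
   (pr (pickle x) (pickle (a x))) = pickle (x, iter (n x) (s x) (a x)).
  by rewrite pickle_pair tail_cons_code head_cons_code.
elim: (n x) => [|k IHk]; first by rewrite pickle_pair.
by rewrite iterS IHk es /= !pickle_pair head_cons_code.
Qed.

(** A function on a finite type only needs a table of its values, whatever the
    codes of the elements are. *)
Lemma computable_fin (T : countType) (F : finType) (U : countType) (h : F -> U)
    (f : T -> F) :
  computable f -> computable (fun x => h (f x)).
Proof.
apply: (computable_comp (f := h)).
pose N := (\max_(x : F) pickle x).+1.
exists (nth 0 (mkseq (fun n => oapp (fun x => pickle (h x)) 0 (unpickle n)) N)).
  exact: unary_rec_nth.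
move=> x; rewrite nth_mkseq ?pickleK //.
by rewrite ltnS (leq_bigmax (F := @pickle F)).
Qed.

Lemma computable_nth (T U : countType) (x0 : U) s (f : T -> nat) :
  computable f -> computable (fun x => nth x0 s (f x)).
Proof.
apply: (computable_comp (f := nth x0 s)).
exists (nth (pickle x0) (map pickle s)); first exact: unary_rec_nth.
move=> n; have [lt_ns|ge_ns] := ltnP n (size s); first by rewrite (nth_map x0).
by rewrite !nth_default ?size_map.
Qed.

Lemma computable_if (T U : countType) (b : T -> bool) (f g : T -> U) :
  computable b -> computable f -> computable g ->
  computable (fun x => if b x then f x else g x).
Proof.
move=> hb hf hg.
have h : computable (fun x => iter (nat_of_bool (b x)) (fun=> f x) (g x)).
  apply: (computable_iter (s := fun x _ => f x)); last by [].
    exact: (@computable_fin _ bool _ nat_of_bool b).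
  exact: computable_comp hf (computable_fst (computable_id _)).
by apply: computable_ext h => x; case: (b x).
Qed.

Lemma computable_eq0 (T : countType) (f : T -> nat) :
  computable f -> computable (fun x => f x == 0).
Proof.
apply: (computable_comp (f := fun n => n == 0)).
exists (nth (pickle false) [:: pickle true]); first exact: unary_rec_nth.
by case=> [|[|n]].
Qed.

(** Codes are injective, and two numbers are equal when both truncated differences
    vanish. *)
Lemma computable_eq (T U : countType) (f g : T -> U) :
  computable f -> computable g -> computable (fun x => f x == g x).
Proof.
move=> hf hg.
apply: (@computable_ext _ _ (fun x => ((pickle (f x) - pickle (g x)) +
   (pickle (g x) - pickle (f x))) == 0)).
  move=> x; rewrite addn_eq0 !subn_eq0 -eqn_leq.
  by rewrite (inj_eq (pcan_inj pickleK)).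
apply: computable_eq0.
by apply: (computable_binary binary_rec_add);
   apply: (computable_binary binary_rec_sub); exact: computable_pickle.
Qed.

Lemma computable_cons (T U : countType) (f : T -> U) (g : T -> seq U) :
  computable f -> computable g -> computable (fun x => f x :: g x).
Proof.
move=> [f' hf ef] [g' hg eg].
exists (fun n => cons_code (f' n) (g' n)).
  exact: (unary_rec_binary binary_rec_cons hf hg).
by move=> x; rewrite ef eg pickle_cons.
Qed.

Lemma computable_behead (T U : countType) (f : T -> seq U) :
  computable f -> computable (fun x => behead (f x)).
Proof.
apply: (computable_comp (f := behead)).
exists tail_code; first exact: unary_rec_tail.
by case=> // x s; rewrite pickle_cons tail_cons_code.
Qed.

Lemma computable_head (T U : countType) (f : T -> U) (g : T -> seq U) :
  computable f -> computable g -> computable (fun x => head (f x) (g x)).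
Proof.
move=> hf hg.
have [k hk ek] : computable (fun x =>
    if g x == [::] then pickle (f x) else head_code (pickle (g x))).
  apply: computable_if; last 2 first.
  - exact: computable_pickle.
  - by apply: (computable_unary unary_rec_head); exact: computable_pickle.
  - by apply: computable_eq => //; exact: computable_const.
exists k => // x; rewrite ek; case: (g x) => // y s.
by rewrite [LHS]/= pickle_cons head_cons_code.
Qed.

Lemma size_code s : size s <= CodeSeq.code s.
Proof.
elim: s => //= n s IHs.
apply: leq_ltn_trans IHs _; rewrite (@leq_trans (CodeSeq.code s).*2.+1) //.
  by rewrite ltnS -addnn leq_addr.
by rewrite leq_pmull // expn_gt0.
Qed.

Lemma computable_foldl (T U E : countType) (s : T -> U -> E -> U) (a : T -> U)
    (l : T -> seq E) :
  computable (fun p : T * (U * E) => s p.1 p.2.1 p.2.2) -> computable a ->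
  computable l -> computable (fun x => foldl (s x) (a x) (l x)).
Proof.
move=> [s' hs es] [a' ha ea] [l' hl el].
pose step (c : nat) (p : nat * nat) := if p.2 == 0 then p else
  (s' (pickle (c, (p.1, head_code p.2))), tail_code p.2) : nat * nat.
(* The state is the pair of the codes of the accumulator and of the unread part
   of the list; one more step on an empty list changes nothing, so that the
   code of the list, an upper bound of its size, can serve as the number of
   steps. *)
have hstep : computable (fun q : nat * (nat * nat) => step q.1 q.2).
  have h1 := computable_fst (computable_id (nat * (nat * nat))%type).
  have h2 := computable_snd (computable_id (nat * (nat * nat))%type).
  have h21 := computable_fst h2; have h22 := computable_snd h2.
  apply: computable_if => //; first exact: computable_eq0.
  apply: computable_pair; last exact: computable_unary unary_rec_tail h22.
  apply: (computable_unary hs); apply: computable_pickle.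
  apply: computable_pair => //; apply: computable_pair => //.
  exact: computable_unary unary_rec_head h22.
have : computable (fun c => (iter (l' c) (step c) (a' c, l' c)).1).
  apply: computable_fst; apply: computable_iter => //.
    exact/computable_nat.
  by apply: computable_pair; exact/computable_nat.
move=> /computable_nat hg.
exists (fun c => (iter (l' c) (step c) (a' c, l' c)).1) => //.
move=> x; rewrite el ea.
suff H : forall n (t : seq E) b, size t <= n ->
    iter n (step (pickle x)) (pickle b, pickle t) =
    (pickle (foldl (s x) b t), 0).
  rewrite H //; apply: leq_trans (size_code _).
  by rewrite size_map.
elim=> [|n IHn] [|y t] b //= le_tn.
  rewrite -iterS iterSr.
  have -> : step (pickle x) (pickle b, pickle ([::] : seq E))
    = (pickle b, pickle ([::] : seq E)) by [].
  exact: IHn.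
rewrite -iterS iterSr.
have -> : step (pickle x) (pickle b, pickle (y :: t)) =
          (pickle (s x b y), pickle t); last exact: IHn.
rewrite /step; case: eqP => [e|_].
  have /(congr1 CodeSeq.decode) : CodeSeq.code (map pickle (y :: t)) = 0 := e.
  by rewrite CodeSeq.codeK.
rewrite [X in head_code X]/= [X in tail_code X]/=.
rewrite !pickle_cons tail_cons_code head_cons_code.
by congr pair; rewrite -(es (x, (b, y))) !pickle_pair.
Qed.

Lemma computable_rev (T E : countType) (l : T -> seq E) :
  computable l -> computable (fun x => rev (l x)).
Proof.
move=> hl.
have h : computable (fun x => foldl (fun acc y => y :: acc) [::] (l x)).
  have h2 := computable_snd (computable_id (T * (seq E * E))%type).
  apply: (computable_foldl (s := fun _ acc y => y :: acc)) => //.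
    apply: computable_cons; first exact: computable_snd.
    exact: computable_fst.
  exact: computable_const.
apply: computable_ext h => x; rewrite -{1}[l x]revK foldl_rev.
by elim: (rev (l x)) => //= a s ->.
Qed.

Lemma computable_foldr (T U E : countType) (s : T -> E -> U -> U) (a : T -> U)
    (l : T -> seq E) :
  computable (fun p : T * (E * U) => s p.1 p.2.1 p.2.2) -> computable a ->
  computable l -> computable (fun x => foldr (s x) (a x) (l x)).
Proof.
move=> hs ha hl.
have h : computable (fun x => foldl (fun acc y => s x y acc) (a x) (rev (l x))).
  apply: (computable_foldl (s := fun x acc y => s x y acc)) => //; last first.
    exact: computable_rev.
  have h1 := computable_fst (computable_id (T * (U * E))%type).
  have h2 := computable_snd (computable_id (T * (U * E))%type).
  apply: (computable_comp (f := fun p : T * (E * U) => s p.1 p.2.1 p.2.2)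
    (g := fun p : T * (U * E) => (p.1, (p.2.2, p.2.1)))) => //.
  apply: computable_pair => //; apply: computable_pair.
    exact: computable_snd.
  exact: computable_fst.
by apply: computable_ext h => x; rewrite foldl_rev.
Qed.

Lemma computable_cat (T E : countType) (f g : T -> seq E) :
  computable f -> computable g -> computable (fun x => f x ++ g x).
Proof.
move=> hf hg.
have h : computable (fun x => foldr cons (g x) (f x)).
  have h2 := computable_snd (computable_id (T * (E * seq E))%type).
  apply: (computable_foldr (s := fun _ => cons)) => //.
  apply: computable_cons; first exact: computable_fst.
  exact: computable_snd.
by apply: computable_ext h => x; elim: (f x) => //= y s ->.
Qed.

Lemma computable_map (T E F : countType) (f : T -> E -> F) (l : T -> seq E) :
  computable (fun p : T * E => f p.1 p.2) -> computable l ->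
  computable (fun x => [seq f x y | y <- l x]).
Proof.
move=> hf hl.
have h : computable (fun x => foldr (fun y acc => f x y :: acc) [::] (l x)).
  apply: (computable_foldr (s := fun x y acc => f x y :: acc)) => //; last first.
    exact: computable_const.
  have h1 := computable_fst (computable_id (T * (E * seq F))%type).
  have h2 := computable_snd (computable_id (T * (E * seq F))%type).
  apply: computable_cons; last exact: computable_snd.
  apply: (computable_comp (f := fun p : T * E => f p.1 p.2)
    (g := fun p : T * (E * seq F) => (p.1, p.2.1))) => //.
  by apply: computable_pair => //; exact: computable_fst.
by apply: computable_ext h => x; elim: (l x) => //= y s ->.
Qed.

Lemma computable_flatten (T E : countType) (l : T -> seq (seq E)) :
  computable l -> computable (fun x => flatten (l x)).
Proof.
move=> hl; apply: (computable_foldr (s := fun _ => cat)) => //.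
  have h2 := computable_snd (computable_id (T * (seq E * seq E))%type).
  by apply: computable_cat; [exact: computable_fst | exact: computable_snd].
exact: computable_const.
Qed.

Lemma computable_has (T E : countType) (p : T -> E -> bool) (l : T -> seq E) :
  computable (fun q : T * E => p q.1 q.2) -> computable l ->
  computable (fun x => has (p x) (l x)).
Proof.
move=> hp hl.
have h : computable (fun x =>
    foldr (fun y acc => if p x y then true else acc) false (l x)).
  have h1 := computable_fst (computable_id (T * (E * bool))%type).
  have h2 := computable_snd (computable_id (T * (E * bool))%type).
  apply: (computable_foldr
    (s := fun x y (acc : bool) => if p x y then true else acc)) => //.
    apply: computable_if; last exact: computable_snd.
      apply: (computable_comp (f := fun p' : T * E => p p'.1 p'.2)
        (g := fun p : T * (E * bool) => (p.1, p.2.1))) => //.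
      by apply: computable_pair => //; exact: computable_fst.
    exact: computable_const.
  exact: computable_const.
by apply: computable_ext h => x; elim: (l x) => //= y s ->.
Qed.

Lemma unary_rec_mul c : unary_rec (muln c).
Proof.
elim: c => [|c IHc]; first exact: unary_rec_const.
exact: unary_rec_binary binary_rec_add unary_rec_id IHc.
Qed.

Lemma computable_size (U E : countType) (l : U -> seq E) :
  computable l -> computable (fun x => size (l x)).
Proof.
move=> hl.
have h : computable (fun x => foldr (fun _ n => n.+1) 0 (l x)).
  apply: (computable_foldr (s := fun _ _ n => n.+1)) => //; last first.
    exact: computable_const.
  apply: (computable_unary unary_rec_succ).
  exact: computable_snd (computable_snd (computable_id _)).
by apply: computable_ext h => x; elim: (l x) => //= y s ->.
Qed.

(** The code of a word in the definition of a decidable language is the code of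
    the list of ranks of its letters; reading it back is a computable lookup. *)
Lemma computable_decidable (B : finType) (L : seq B -> Prop) :
  computable (fun w : seq B => `[< L w >]) -> decidable_language L.
Proof.
move=> hL.
pose decode (s : seq nat) : seq B :=
  flatten [seq nth [::] [seq [:: x] | x <- enum B] i | i <- s].
have [f hf ef] : computable (fun s => nat_of_bool `[< L (decode s) >]).
  apply: (@computable_fin _ bool _ nat_of_bool).
  apply: (computable_comp hL); apply: computable_flatten.
  apply: (computable_map (f := fun _ => nth [::] [seq [:: x] | x <- enum B])).
    exact: computable_nth (computable_snd (computable_id _)).
  exact: computable_id.
exists (fun v => f (tnth v ord0)) => // w.
have -> : tnth [tuple word_code w] ord0 =
    choice.pickle [seq nat_of_ord (enum_rank x) | x <- w].
  by rewrite (tnth_nth 0) /= /word_code; congr CodeSeq.code; rewrite map_id.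
rewrite ef; congr (nat_of_bool `[< L _ >]); rewrite /decode -map_comp.
rewrite -[RHS]flatten_seq1 -[in RHS](map_id w) -map_comp; congr flatten.
apply: eq_map => x /=.
by rewrite (nth_map x) ?nth_enum_rank // -cardE ltn_ord.
Qed.

Local Open Scope group_scope.

(** * Evaluating words in groups *)

Lemma word_eval_nil (T : Type) (G : groupType) (h : T -> G) :
  word_eval h [::] = 1.
Proof. exact: big_nil. Qed.

Lemma word_eval_cons (T : Type) (G : groupType) (h : T -> G) x w :
  word_eval h (x :: w) = (if x.2 then (h x.1)^-1 else h x.1) * word_eval h w.
Proof. exact: big_cons. Qed.

Lemma word_eval_cat (T : Type) (G : groupType) (h : T -> G) w1 w2 :
  word_eval h (w1 ++ w2) = word_eval h w1 * word_eval h w2.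
Proof. exact: big_cat. Qed.

Lemma word_eval_map (T U : Type) (G : groupType) (h : U -> G) (k : T -> U) w :
  word_eval h [seq (k x.1, x.2) | x <- w] = word_eval (h \o k) w.
Proof. exact: big_map. Qed.

Lemma morph1 (G H : groupType) (f : G -> H) :
  {morph f : x y / x * y} -> f 1 = 1.
Proof. by move=> fM; apply: (mulgI (f 1)); rewrite -fM !mulg1. Qed.

Lemma morphV (G H : groupType) (f : G -> H) :
  {morph f : x y / x * y} -> {morph f : x / x^-1}.
Proof.
by move=> fM x; apply: (mulgI (f x)); rewrite -fM !mulgV morph1.
Qed.

Lemma morph_prod (G H : groupType) (f : G -> H) : {morph f : x y / x * y} ->
  forall s, f (\prod_(x <- s) x) = \prod_(x <- map f s) x.
Proof.
move=> fM; elim=> [|x s IHs]; first by rewrite !big_nil morph1.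
by rewrite /= !big_cons fM IHs.
Qed.

Lemma morph_word_eval (T : Type) (G H : groupType) (f : G -> H) (h : T -> G) w :
  {morph f : x y / x * y} -> f (word_eval h w) = word_eval (f \o h) w.
Proof.
move=> fM; elim: w => [|[t b] w IHw]; first by rewrite !word_eval_nil morph1.
by rewrite !word_eval_cons fM IHw /=; case: b => //; rewrite morphV.
Qed.

(** The universal property of a presentation: relations that hold in a group
    give a homomorphism to that group. *)
Lemma word_cong_eval (T : Type) (G : groupType) (h : T -> G) R w1 w2 :
  (forall v1 v2, R v1 v2 -> word_eval h v1 = word_eval h v2) ->
  word_cong R w1 w2 -> word_eval h w1 = word_eval h w2.
Proof.
move=> hR; elim=> // [v1 v2 v3 _ -> _ -> //|v1 v2 v3 v4 _ e _ e'|t b].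
  by rewrite !word_eval_cat e e'.
by rewrite !word_eval_cons word_eval_nil; case: b;
   rewrite /= mulg1 ?mulVg ?mulgV.
Qed.

Section Presented.
Variables (T : choiceType) (R : word T -> word T -> Prop).

Lemma pres_class_cat w1 w2 :
  pres_class R (w1 ++ w2) = pres_class R w1 * pres_class R w2.
Proof. by rewrite [RHS]pres_mulE. Qed.

Lemma pres_class_inv w : pres_class R (inv_word w) = (pres_class R w)^-1.
Proof. by rewrite [RHS]pres_invE. Qed.

Definition pres_lift (G : groupType) (h : T -> G) (x : presented R) : G :=
  word_eval h (repr x).

Lemma pres_lift_class (G : groupType) (h : T -> G) w :
  (forall v1 v2, R v1 v2 -> word_eval h v1 = word_eval h v2) ->
  pres_lift h (pres_class R w) = word_eval h w.
Proof. by move=> hR; apply: word_cong_eval (word_cong_repr R w). Qed.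

Lemma pres_liftM (G : groupType) (h : T -> G) :
  (forall v1 v2, R v1 v2 -> word_eval h v1 = word_eval h v2) ->
  {morph pres_lift h : x y / x * y}.
Proof.
move=> hR x y; rewrite -[x]pres_classK -[y]pres_classK -pres_class_cat.
by rewrite !pres_lift_class // word_eval_cat.
Qed.

End Presented.

Section FreeLift.
Variables (T : choiceType) (G : groupType) (h : T -> G).

Lemma free_class_cat (w1 w2 : word T) :
  free_class (w1 ++ w2) = free_class w1 * free_class w2.
Proof. exact: pres_class_cat. Qed.

Lemma free_classK (x : free_group T) : free_class (repr x) = x.
Proof. exact: pres_classK. Qed.

Lemma free_liftM : {morph free_lift h : x y / x * y}.
Proof.
move=> x y; rewrite -[x]free_classK -[y]free_classK -free_class_cat.
by rewrite !free_lift_class word_eval_cat.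
Qed.

End FreeLift.

Lemma free_lift_map (T U : choiceType) (G : groupType) (h : U -> G)
    (k : T -> U) x :
  free_lift h (free_map k x) = free_lift (h \o k) x.
Proof.
rewrite -[x]free_classK /free_map !free_lift_class.
rewrite morph_word_eval; last exact: free_liftM.
congr (word_eval _ _); apply/funext => t /=.
by rewrite free_lift_class word_eval_cons word_eval_nil mulg1.
Qed.

Lemma free_map_class (T U : choiceType) (k : T -> U) w :
  free_map k (free_class w) = free_class [seq (k x.1, x.2) | x <- w].
Proof.
rewrite /free_map free_lift_class -[RHS](word_eval_pres_gen (@no_relation U)).
by rewrite word_eval_map.
Qed.

(** * Reduced words in free groups *)

Section Reduced.
Variable T : choiceType.
Implicit Types (x y : T * bool) (w v : word T).

Definition flip x := (x.1, ~~ x.2).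

Lemma flipK : involutive flip.
Proof. by case=> t b; rewrite /flip /= negbK. Qed.

Definition push x w :=
  if w is y :: w' then if y == flip x then w' else x :: w else [:: x].

Definition reduce w := foldr push [::] w.

Definition reduced w := sorted (fun x y => y != flip x) w.

Lemma reduced_push x w : reduced w -> reduced (push x w).
Proof.
case: w => //= y w; rewrite /reduced; case: eqP => [_ /path_sorted //|].
by move=> /eqP ne /= ->; rewrite ne.
Qed.

Lemma reduced_foldr w v : reduced v -> reduced (foldr push v w).
Proof. by move=> rv; elim: w => //= x w; exact: reduced_push. Qed.

Lemma reduced_reduce w : reduced (reduce w).
Proof. exact: reduced_foldr. Qed.

Lemma reduce_id w : reduced w -> reduce w = w.
Proof.
rewrite /reduced; elim: w => //= x w IHw pw.
have := IHw (path_sorted pw); rewrite /reduce => ->.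
by case: w pw {IHw} => //= y w /andP[/negbTE-> _].
Qed.

(** On reduced words, pushing a letter undoes pushing its inverse.  Letters thus
    act by permutations on reduced words, which is why a group element has only
    one reduced word. *)
Lemma push_flip x w : reduced w -> push x (push (flip x) w) = w.
Proof.
case: w => [|y w] rw; first by rewrite /= eqxx.
rewrite [push (flip x) _]/= flipK; case: eqP => [ey|ne]; last by rewrite /= eqxx.
case: w rw => [|z w]; first by rewrite ey.
by rewrite ey /= => /andP[/negbTE-> _].
Qed.

Lemma foldr_push_cong w1 w2 v : word_cong (@no_relation T) w1 w2 ->
  reduced v -> foldr push v w1 = foldr push v w2.
Proof.
move=> cong; elim: cong v => //=.
- by move=> v1 v2 _ IH v rv; rewrite IH.
- by move=> v1 v2 v3 _ IH12 _ IH23 v rv; rewrite IH12 // IH23.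
- move=> v1 v2 v3 v4 _ IH12 _ IH34 v rv; rewrite !foldr_cat IH34 //.
  by rewrite IH12 //; exact: reduced_foldr.
- by move=> t b v rv; have := push_flip (t, b) rv.
Qed.

Lemma free_class_push x w : free_class (push x w) = free_class (x :: w).
Proof.
case: w => [|y w] //=; case: eqP => // ->; apply/pres_classP/word_cong_sym.
case: x => t b.
exact: (word_cong_cat (word_cong_cancel (@no_relation T) t b)
  (word_cong_refl _ w)).
Qed.

Lemma free_class_cons x w :
  free_class (x :: w) = free_class [:: x] * free_class w.
Proof. by rewrite -free_class_cat. Qed.

Lemma free_class_reduce w : free_class (reduce w) = free_class w.
Proof.
elim: w => //= x w IHw; rewrite free_class_push free_class_cons.
by rewrite -/(reduce w) IHw -free_class_cons.
Qed.

Lemma free_class_eqP w1 w2 :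
  free_class w1 = free_class w2 <-> reduce w1 = reduce w2.
Proof.
split=> [/pres_classP cong|e]; first exact: foldr_push_cong.
by rewrite -free_class_reduce e free_class_reduce.
Qed.

Definition normal_word (g : free_group T) := reduce (repr g).

Lemma normal_word_class w : normal_word (free_class w) = reduce w.
Proof. by apply/free_class_eqP; rewrite free_classK. Qed.

Lemma normal_wordK g : free_class (normal_word g) = g.
Proof. by rewrite free_class_reduce free_classK. Qed.

Lemma reduced_normal_word g : reduced (normal_word g).
Proof. exact: reduced_reduce. Qed.

Definition flen g := size (normal_word g).

Lemma size_push x w : size (push x w) <= (size w).+1.
Proof. by case: w => //= y w; case: ifP => //= _; rewrite leqW. Qed.

Lemma flen_class w : flen (free_class w) <= size w.
Proof.
rewrite /flen normal_word_class; elim: w => //= x w IHw.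
by apply: leq_trans (size_push _ _) _; rewrite ltnS.
Qed.

Lemma flenM g h : flen (g * h) <= flen g + flen h.
Proof.
rewrite -{1}[g]normal_wordK -{1}[h]normal_wordK -free_class_cat -size_cat.
exact: flen_class.
Qed.

Lemma size_inv_word w : size (inv_word w) = size w.
Proof. by rewrite size_rev size_map. Qed.

Lemma free_class_inv w : free_class (inv_word w) = (free_class w)^-1.
Proof. exact: pres_class_inv. Qed.

Lemma flenV g : flen g^-1 <= flen g.
Proof.
rewrite -{1}[g]normal_wordK -free_class_inv; apply: leq_trans (flen_class _) _.
by rewrite size_inv_word.
Qed.

Lemma reduced_inv w : reduced w -> reduced (inv_word w).
Proof.
rewrite /reduced /inv_word rev_sorted sorted_map; congr (is_true _).
case: w => //= x w; elim: w x => //= y w IHw x; rewrite IHw; congr (_ && _).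
rewrite /flip /=; case: x y => [t b] [t' b'] /=; rewrite !xpair_eqE /=.
by rewrite eq_sym; case: b; case: b'.
Qed.

(** The triangle formed by 1, g and h degenerates at 1 when the reduced words of g
    and h do not start with the same letter: nothing cancels in g^-1 h. *)
Lemma flen_div g x h :
  normal_word h = x :: behead (normal_word h) ->
  ohead (normal_word g) != Some x ->
  flen (g^-1 * h) = (flen g + flen h)%N.
Proof.
move=> hx gx; rewrite /flen -{1}[g]normal_wordK -{1}[h]normal_wordK.
rewrite -free_class_inv -free_class_cat.
rewrite normal_word_class reduce_id ?size_cat ?size_inv_word //.
have := reduced_inv (reduced_normal_word g); have := reduced_normal_word h.
move: gx; rewrite hx; move: (behead (normal_word h)) => r.
case: (normal_word g) => [|y s] //.
rewrite [ohead _]/= (inj_eq Some_inj) => ne rh rg.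
have -> : inv_word (y :: s) = rcons (inv_word s) (flip y).
  by rewrite /inv_word /= rev_cons.
move: rg; rewrite /inv_word /= rev_cons -/(inv_word s) /reduced => rg.
rewrite cat_rcons.
case: (inv_word s) rg => [_|z s'].
  by move: rh; rewrite /reduced /= => ->; rewrite flipK eq_sym ne.
rewrite /= rcons_path cat_path /= => /andP[-> ->]; rewrite flipK eq_sym ne.
exact: rh.
Qed.

End Reduced.

(** * Lengths of factorizations in free groups *)

Section Crossing.
Variables (T : choiceType) (L : nat).
Implicit Types (g h : free_group T).

Lemma flen_behead x g : ohead (normal_word g) = Some x ->
  (flen ((free_class [:: x])^-1 * g)).+1 <= flen g.
Proof.
move=> gx; have e : normal_word g = x :: behead (normal_word g).
  by case: (normal_word g) gx => //= z r [->].
rewrite -[g in X in X <= _]normal_wordK e (free_class_cons x (behead _)) mulKg.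
rewrite [flen g]/flen e ltnS.
exact: flen_class.
Qed.

(** The edge from 1 to the letter x separates the words that start with x from the
    others.  A step that crosses it passes through x, so that the endpoint of the
    step is closer to x than the length of the step. *)
Lemma crossing_from_outside x h s : ohead (normal_word h) != Some x ->
  ohead (normal_word (h * \prod_(y <- s) y)) = Some x ->
  (forall y, y \in s -> flen y <= L) ->
  exists s1 s2, s = s1 ++ s2 /\
    flen ((free_class [:: x])^-1 * (h * \prod_(y <- s1) y)) <= L.
Proof.
elim: s h => [|y s IHs] h hx.
  by rewrite big_nil mulg1 => e; rewrite e eqxx in hx.
rewrite big_cons mulgA => hsx hL.
have [hyx|nhyx] := eqVneq (ohead (normal_word (h * y))) (Some x); last first.
  have [|s1 [s2 [-> le1]]] := IHs _ nhyx hsx.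
    by move=> z zs; rewrite hL // inE zs orbT.
  by exists (y :: s1), s2; rewrite big_cons [h * (y * _)]mulgA.
exists [:: y], s; split=> //; rewrite big_seq1.
have e : normal_word (h * y) = x :: behead (normal_word (h * y)).
  by case: (normal_word _) hyx => //= z r [->].
have := flen_div e hx; rewrite mulKg => ey.
apply: leq_trans (hL y (mem_head _ _)).
by rewrite ey; apply: leq_trans (leq_addl _ _); apply: ltnW; exact: flen_behead.
Qed.

(** If the path already starts inside the subtree at x, its starting point h,
    being of length at most L, is itself within distance L of x. *)
Lemma crossing x h s : ohead (normal_word (h * \prod_(y <- s) y)) = Some x ->
  flen h <= L -> (forall y, y \in s -> flen y <= L) ->
  exists s1 s2, s = s1 ++ s2 /\
    flen ((free_class [:: x])^-1 * (h * \prod_(y <- s1) y)) <= L.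
Proof.
move=> hsx hL sL.
have [hx|nhx] := eqVneq (ohead (normal_word h)) (Some x); last first.
  exact: crossing_from_outside.
exists [::], s; split=> //; rewrite big_nil mulg1.
by have := flen_behead hx; lia.
Qed.

End Crossing.

(** For a finite set X this is the finiteness condition in the definition of a
    graded monoid, for the generating set X itself. *)
Definition bounded_factorizations (G : monoidType) (X : {fset G}) : Prop :=
  forall m, exists B, forall s, words_for X m s -> size s <= B.

(** A bound for each single element gives a uniform bound on a ball, because balls
    in a finitely generated free group are finite. *)
Lemma ball_bound (T : finType) (R : nat) (P : free_group T -> nat -> Prop) :
  (forall g, exists B, forall n, P g n -> n <= B) ->
  exists B, forall g n, flen g <= R -> P g n -> n <= B.
Proof.
move=> /choice[B hB]; exists (\max_(w : R.-bseq (T * bool)) B (free_class w)).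
move=> g n gR /hB le_n; apply: leq_trans le_n _.
have -> : g = free_class (insub_bseq R (normal_word g)).
  by rewrite /insub_bseq insubdK ?normal_wordK.
exact: (leq_bigmax (F := fun w : R.-bseq (T * bool) => B (free_class w))).
Qed.

(** The error q in the inductive statement is the displacement of the cutting
    point of the path from the vertex at which it was to be cut.  A piece between
    two consecutive cuts has a product of length at most L + 1 + L, which is why
    the uniform bound C is taken over the ball of that radius. *)
Theorem linear_factorizations (T : finType) (X : {fset free_group T}) :
  bounded_factorizations X ->
  exists C, forall s : seq (free_group T), {subset s <= X} ->
    size s <= C * (flen (\prod_(x <- s) x)).+1.
Proof.
move=> hX.
pose L := \max_(x <- X) flen x.
have XL x : x \in X -> flen x <= L.
  by move=> xX; rewrite /L (big_rem x) //= leq_maxl.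
have [|C hC] := @ball_bound T (L + L).+1
   (fun g n => exists2 s, words_for X g s & size s = n).
  by move=> g; have [B hB] := hX g; exists B => n [s /hB ? <-].
have main w : reduced w -> forall q (s : seq (free_group T)), flen q <= L ->
    {subset s <= X} -> \prod_(x <- s) x = q * free_class w ->
    size s <= C * (size w).+1.
  elim: w => [|a w IHw] rw q s qL sX es.
    rewrite muln1; apply: (hC q); first by lia.
    by exists s => //; split=> //; rewrite es mulg1.
  have [|||s1 [s2 [e12 pL]]] := @crossing T L a q^-1 s.
  - by rewrite es mulKg normal_word_class reduce_id.
  - exact: leq_trans (flenV _) qL.
  - by move=> y /sX /XL.
  (* The partial product q * a * p is a vertex within distance L of q * a. *)
  set p := (X in flen X) in pL.
  have [s1X s2X] : {subset s1 <= X} /\ {subset s2 <= X}.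
    by split=> y ys; apply: sX; rewrite e12 mem_cat ys ?orbT.
  have e1 : \prod_(x <- s1) x = q * (free_class [:: a] * p).
    by rewrite /p mulVKg mulVKg.
  have le1 : size s1 <= C.
    apply: (hC (\prod_(x <- s1) x)); last by exists s1.
    rewrite e1; apply: leq_trans (flenM _ _) _.
    have := flenM (free_class [:: a]) p; have := flen_class [:: a].
    rewrite [size _]/=; lia.
  have le2 : size s2 <= C * (size w).+1.
    apply: (IHw _ p^-1) => //; first exact: path_sorted rw.
      exact: leq_trans (flenV _) pL.
    apply: (mulgI (\prod_(x <- s1) x)).
    have -> : (\prod_(x <- s1) x) * (\prod_(x <- s2) x) = \prod_(x <- s) x.
      by rewrite e12 big_cat.
    by rewrite e1 es (free_class_cons a w) -2!(mulgA _ _ (p^-1 * _)) mulVKg.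
  by rewrite e12 size_cat [size (a :: w)]/= mulnS leq_add.
exists C => s sX; apply: (main _ (reduced_normal_word _) 1) => //.
  by rewrite /flen (normal_word_class [::]).
by rewrite mul1g normal_wordK.
Qed.

Lemma finite_set_bound (T : Type) (f : T -> nat) (A : set T) : finite_set A ->
  exists B, forall x, A x -> f x <= B.
Proof.
move=> /(finite_image f)/finite_seqP[s es].
exists (\max_(n <- s) n) => x Ax.
have fs : f x \in s.
  by have : (f @` A)%classic (f x) := ex_intro2 _ _ x Ax erefl; rewrite es.
by rewrite (big_rem (f x)) //= leq_maxl.
Qed.

Lemma finite_words (G : choiceType) (X : {fset G}) n :
  finite_set [set s | {subset s <= X} /\ size s <= n]%classic.
Proof.
elim: n => [|n IHn].
  apply: sub_finite_set (finite_set1 [::]) => s [_].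
  by rewrite leqn0 size_eq0 => /eqP.
have finX : finite_set [set` X] by exact: finite_fset.
apply: sub_finite_set (_ : finite_set ([set [::]] `|`
   [set x :: s | x in [set` X] &
     s in [set s | {subset s <= X} /\ size s <= n]])%classic).
  move=> [|x s] [sX ?]; first by left.
  right; exists x; first by apply: sX; rewrite mem_head.
  by exists s => //; split=> // y ys; apply: sX; rewrite inE ys orbT.
by rewrite finite_setU; split; [exact: finite_set1 | exact: finite_image2].
Qed.

Section Factorizations.
Variable G : monoidType.
Implicit Types (X Y S : {fset G}) (s : seq G).

(** Words over one set are translated into words over another by substituting a
    word for each letter. *)
Lemma words_for_subst S Y : (forall y, y \in Y -> submonoid_gen S y) ->
  exists t : G -> seq G, (forall y, y \in Y -> words_for S y (t y)) /\
    forall s, {subset s <= Y} ->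
      words_for S (\prod_(x <- s) x) (flatten (map t s)).
Proof.
move=> YS; have /choice[t ht] y : exists w, y \in Y -> words_for S y w.
  by have [/YS[w]|] := boolP (y \in Y); [exists w | exists [::]].
exists t; split=> //; elim=> [|x s IHs] sY.
  by rewrite big_nil; split; rewrite ?big_nil.
have [tX et] := ht x (sY x (mem_head _ _)).
have [|fX ef] := IHs; first by move=> y ys; apply: sY; rewrite inE ys orbT.
split=> /=; last by rewrite big_cat big_cons et ef.
by move=> y; rewrite mem_cat => /orP[/tX|/fX].
Qed.

(** Gradedness concerns some generating set S.  An element of X is not 1, so that
    it is a nonempty word over S; substitution therefore does not shorten words,
    and the finitely many words over S for m bound the words over X for m. *)
Lemma graded_bounded X : 1 \notin X -> graded (submonoid_gen X) ->
  bounded_factorizations X.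
Proof.
move=> X1 [S [eSX finS]] m.
have XS x : x \in X -> submonoid_gen S x.
  move=> xX; rewrite eSX; exists [:: x]; split; last by rewrite big_seq1.
  by move=> y; rewrite inE => /eqP->.
have [t [ht hs]] := words_for_subst XS.
have [Sm|nSm] := pselect (submonoid_gen S m); last first.
  by exists 0 => s [/hs] sS e; case: nSm; exists (flatten (map t s)); rewrite -e.
have [B hB] := finite_set_bound size (finS m (ltac:(by rewrite -eSX))).
exists B => s [sX es]; apply: leq_trans (hB (flatten (map t s)) _); last first.
  by rewrite -es; exact: hs.
elim: s sX {es} => //= x s IHs sX; rewrite size_cat -add1n leq_add //.
  have xX := sX x (mem_head _ _); have [_ etx] := ht x xX.
  case: (t x) etx => //; rewrite big_nil => e1.
  by rewrite e1 xX in X1.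
by apply: IHs => y ys; apply: sX; rewrite inE ys orbT.
Qed.

Lemma bounded_graded X : bounded_factorizations X -> graded (submonoid_gen X).
Proof.
move=> hX; exists X; split=> // m _; have [B hB] := hX m.
apply: sub_finite_set (finite_words X B) => s ms; split; last exact: hB.
by case: ms.
Qed.

Lemma gen_length_le S m s : words_for S m s -> gen_length S m <= size s.
Proof.
move=> ms; rewrite /gen_length; case: pselect => [h|]; last first.
  by case; exists (size s); apply/asboolP; exists s.
by case: ex_minnP => k _; apply; apply/asboolP; exists s.
Qed.

Lemma gen_length_attained S m : submonoid_gen S m ->
  exists2 s, words_for S m s & size s = gen_length S m.
Proof.
case=> s ms; rewrite /gen_length; case: pselect => [h|]; last first.
  by case; exists (size s); apply/asboolP; exists s.
by case: ex_minnP => k /asboolP.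
Qed.

Lemma gen_length_change S Y : (forall y, y \in Y -> submonoid_gen S y) ->
  exists c, forall m s, words_for Y m s -> gen_length S m <= c * size s.
Proof.
move=> YS; have [t [ht hs]] := words_for_subst YS.
exists (\max_(y <- Y) size (t y)) => m s [sY <-].
apply: leq_trans (gen_length_le (hs s sY)) _.
elim: s sY => //= x s IHs sY; rewrite size_cat mulnS leq_add //.
  by rewrite (big_rem x) ?leq_maxl //; apply: sY; rewrite mem_head.
by apply: IHs => y ys; apply: sY; rewrite inE ys orbT.
Qed.

End Factorizations.

(** * Pulling factorizations back along a homomorphism *)

(** A homomorphism that maps Y into X maps words over Y to words over X of the
    same size, so that all bounds for X hold for Y. *)
Section Pullback.
Variables (G : groupType) (T : finType) (f : G -> free_group T).
Variables (Y : {fset G}) (X : {fset free_group T}).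
Hypothesis fM : {morph f : x y / x * y}.
Hypothesis fYX : forall y, y \in Y -> f y \in X.
Hypothesis hX : bounded_factorizations X.

Lemma words_for_image m s : words_for Y m s -> words_for X (f m) (map f s).
Proof.
case=> sY <-; split; last by rewrite morph_prod.
by move=> _ /mapP[y /sY /fYX fy ->].
Qed.

Lemma bounded_pullback : bounded_factorizations Y.
Proof.
move=> m; have [B hB] := hX (f m); exists B => s /words_for_image/hB.
by rewrite size_map.
Qed.

Lemma linear_pullback : exists C, forall m s, words_for Y m s ->
  size s <= C * (flen (f m)).+1.
Proof.
have [C hC] := linear_factorizations hX; exists C => m s /words_for_image[sX <-].
by rewrite -(size_map f); exact: hC.
Qed.

Lemma flen_image (Z : {fset G}) :
  exists L, forall m s, words_for Z m s -> flen (f m) <= L * size s.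
Proof.
exists (\max_(z <- Z) flen (f z)) => m s [sZ <-].
rewrite morph_prod //; elim: s sZ => [|x s IHs] sZ.
  by rewrite big_nil muln0 /flen (normal_word_class [::]).
rewrite /= big_cons; apply: leq_trans (flenM _ _) _; rewrite mulnS leq_add //.
  by rewrite (big_rem x) ?leq_maxl //; apply: sZ; rewrite mem_head.
by apply: IHs => y ys; apply: sZ; rewrite inE ys orbT.
Qed.

Lemma linear_distortion (S X0 : {fset G}) :
  submonoid_gen S = submonoid_gen Y -> submonoid_gen X0 = setT ->
  exists2 delta, distortion_function (submonoid_gen Y) S X0 delta &
    linearly_bounded delta.
Proof.
move=> eSY eX0.
have YS y : y \in Y -> submonoid_gen S y.
  move=> yY; rewrite eSY; exists [:: y]; split; last by rewrite big_seq1.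
  by move=> z; rewrite inE => /eqP->.
have [c hc] := gen_length_change YS.
have [C hC] := linear_pullback; have [L hL] := flen_image X0.
(* Here n bounds the length over X0, L * n the reduced length of the image,
   C * (L * n).+1 the number of factors in Y, and c accounts for the change of
   generators from Y to S. *)
exists (fun n => c * (C * (L * n).+1))%N.
  split=> [m n le_mn|m [s ms]].
    by rewrite leq_mul2l leq_mul2l ltnS leq_mul2l le_mn !orbT.
  apply: leq_trans (hc _ _ ms) _; rewrite leq_mul2l; apply/orP; right.
  apply: leq_trans (hC _ _ ms) _; rewrite leq_mul2l ltnS; apply/orP; right.
  have [|s0 ms0 <-] := @gen_length_attained _ X0 m; first by rewrite eX0.
  exact: hL.
exists (c * C * L).+1, (c * C).+1; split=> // n.
by rewrite mulnA mulnS addnC -mulnA leq_add // mulSn mulnA mulnA leq_addl.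
Qed.

End Pullback.

(** * Normal forms of an amalgam of two copies of a group *)

(** Two copies of F, indexed by booleans, are amalgamated along the subgroup H.
    Each right coset H g gets a representative, which is 1 for H itself, and a
    normal form is a product of an element of H and of nontrivial representatives
    taken alternately from the two copies. *)
Section CosetAction.
Variables (F : groupType) (H : set F).
Hypotheses (H1 : H 1) (HM : forall x y, H x -> H y -> H (x * y)).
Hypothesis HV : forall x, H x -> H x^-1.
Implicit Types (g h x : F) (s : bool) (l : seq (bool * F)).

Let H_mulr h g : H h -> H (h * g) -> H g.
Proof. by move=> Hh Hhg; rewrite -(mulKg h g); apply: HM => //; exact: HV. Qed.

Let H_mull h g : H h -> H (g * h) -> H g.
Proof. by move=> Hh Hgh; rewrite -(mulgK h g); apply: HM => //; exact: HV. Qed.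

Definition coset_rep g : F :=
  if `[< H g >] then 1 else choose (fun y => `[< H (y * g^-1) >]) g.

Lemma coset_repP g : H (coset_rep g * g^-1).
Proof.
rewrite /coset_rep; case: asboolP => [Hg|_]; first by rewrite mul1g; exact: HV.
apply/asboolP; apply: (@chooseP _ (fun y => `[< H (y * g^-1) >]) g).
by apply/asboolP; rewrite mulgV.
Qed.

Lemma coset_repM h g : H h -> coset_rep (h * g) = coset_rep g.
Proof.
move=> Hh; rewrite /coset_rep.
have -> : `[< H (h * g) >] = `[< H g >].
  by apply/asboolP/asboolP => [|Hg]; [exact: H_mulr | exact: HM].
case: asboolP => // nHg; set P := (X in choose X _ = _).
have eP : P =1 (fun y => `[< H (y * g^-1) >]).
  move=> y; rewrite /P invgM mulgA.
  apply/asboolP/asboolP => [|Hy]; first by apply: H_mull; exact: HV.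
  by apply: HM => //; exact: HV.
rewrite (eq_choose eP); apply: choose_id; apply/asboolP; rewrite ?mulgV //.
by rewrite mulgK.
Qed.

Lemma coset_rep_id g : coset_rep (coset_rep g) = coset_rep g.
Proof.
by rewrite -{1}[coset_rep g](mulgVK g) coset_repM //; exact: coset_repP.
Qed.

Lemma coset_rep_eq1 g : coset_rep g = 1 <-> H g.
Proof.
split=> [e|Hg]; last by rewrite /coset_rep; case: asboolP.
by have := coset_repP g; rewrite e mul1g => /HV; rewrite invgK.
Qed.

Definition alternating l : Prop :=
  (forall c, c \in l -> coset_rep c.2 = c.2 /\ ~ H c.2) /\
  sorted (fun c d => c.1 != d.1) l.

Definition starts_off s l : bool := if l is c :: _ then c.1 != s else true.

Definition normal (p : F * seq (bool * F)) : Prop := H p.1 /\ alternating p.2.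

(** Seen from the copy s, a normal form is a pair of an element of F and of a list
    that does not start with a syllable of the copy s: the element of H is
    multiplied with the first syllable if this one belongs to the copy s.
    The inverse [fold_head] splits the element of F again. *)
Definition unfold_head s (p : F * seq (bool * F)) : F * seq (bool * F) :=
  if p.2 is c :: l then if c.1 == s then (p.1 * c.2, l) else p else p.

Definition fold_head s (p : F * seq (bool * F)) : F * seq (bool * F) :=
  (p.1 * (coset_rep p.1)^-1,
   if coset_rep p.1 == 1 then p.2 else (s, coset_rep p.1) :: p.2).

(** Seen from the copy s, F acts by left multiplication on the first component.
    The two actions agree on H ([side_act_base]), hence define an action of the
    amalgam. *)
Definition side_act s x (p : F * seq (bool * F)) :=
  fold_head s (x * (unfold_head s p).1, (unfold_head s p).2).

Lemma unfold_fold s p : starts_off s p.2 -> unfold_head s (fold_head s p) = p.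
Proof.
case: p => g l /= sl; rewrite /fold_head /=; case: eqP => [->|_].
  rewrite invg1 mulg1 /unfold_head /=; case: l sl => //= c l.
  by move=> /negbTE->.
by rewrite /unfold_head /= eqxx mulgVK.
Qed.

Lemma fold_unfold s p : normal p -> fold_head s (unfold_head s p) = p.
Proof.
case: p => h l [/= Hh [la ls]].
have e : fold_head s (h, l) = (h, l).
  have e1 : coset_rep h = 1 by apply/coset_rep_eq1.
  by rewrite /fold_head /= e1 eqxx invg1 mulg1.
rewrite /unfold_head; case: l la ls e => //= -[s' c] l la ls e.
case: eqP => // <-; rewrite /fold_head /= coset_repM //.
have [-> nHc] := la _ (mem_head _ _); rewrite mulgK; case: eqP => // e1.
by case: nHc; rewrite e1.
Qed.

Lemma unfold_normal s p : normal p ->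
  alternating (unfold_head s p).2 /\ starts_off s (unfold_head s p).2.
Proof.
case: p => h l [/= Hh [la ls]]; rewrite /unfold_head /=.
case: l la ls => [|[s' c] l] la ls //.
case: (eqVneq s' s) => [<-|/negbTE ne]; rewrite /= ?eqxx ?ne /=; last first.
  by split=> //; rewrite ne.
split; first split.
- by move=> d dl; apply: la; rewrite inE dl orbT.
- exact: path_sorted ls.
- by case: l ls {la} => //= d l /andP[]; rewrite eq_sym.
Qed.

Lemma fold_normal s p : alternating p.2 -> starts_off s p.2 ->
  normal (fold_head s p).
Proof.
case: p => g l /= [la ls] sl; rewrite /fold_head; split=> /=.
  by rewrite -(invgK g) -invgM invgK; apply: HV; exact: coset_repP.
case: eqP => // /coset_rep_eq1 nHg.
have nHr : ~ H (coset_rep g).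
  by move=> /coset_rep_eq1; rewrite coset_rep_id => /coset_rep_eq1.
split=> [c|].
  by rewrite inE => /predU1P[->|/la//] /=; rewrite coset_rep_id.
by case: l sl ls {la} => //= d l; rewrite eq_sym => -> ->.
Qed.

Lemma side_act_normal s x p : normal p -> normal (side_act s x p).
Proof. by move=> /(unfold_normal s)[la sl]; exact: fold_normal. Qed.

Lemma side_actM s x y p : normal p ->
  side_act s x (side_act s y p) = side_act s (x * y) p.
Proof.
move=> /(unfold_normal s)[la sl].
by rewrite {1}/side_act unfold_fold //= mulgA.
Qed.

Lemma side_act1 s p : normal p -> side_act s 1 p = p.
Proof.
by move=> np; rewrite /side_act mul1g -surjective_pairing fold_unfold.
Qed.

Lemma side_act_base s x p : H x -> normal p -> side_act s x p = (x * p.1, p.2).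
Proof.
move=> Hx np; have := fold_unfold s np; rewrite /side_act.
move: (unfold_head s p) => [g l]; case: p np => h l' _.
by rewrite /fold_head /= coset_repM // => -[<- <-]; rewrite mulgA.
Qed.

Lemma side_act_push s x p : ~ H x -> normal p -> starts_off s p.2 ->
  exists h c, side_act s x p = (h, (s, c) :: p.2).
Proof.
case: p => h l nHx [/= Hh _] sl.
have -> : side_act s x (h, l) = fold_head s (x * h, l).
  rewrite /side_act /unfold_head /=; case: l sl => //= c l.
  by move=> /negbTE->.
rewrite /fold_head /=; case: eqP => [/coset_rep_eq1 Hxh|_]; last by do 2!eexists.
by case: nHx; exact: H_mull Hxh.
Qed.

End CosetAction.

(** * The double of a free group along a cyclic subgroup *)
Section Double.
Variables (A A' : finType) (phi : A -> A') (psi : A' -> A) (u : free_group A).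
Hypotheses (phiK : cancel phi psi) (psiK : cancel psi phi).

Local Notation FA := (free_group A).
Local Notation G := (double_group phi u).
Local Notation rel := (double_relation phi u).

Definition copy_letter (s : bool) (a : A) : A + A' :=
  if s then inr (phi a) else inl a.

Definition copy (s : bool) (x : FA) : G :=
  if s then double_inr phi u (free_map phi x) else double_inl phi u x.

Arguments copy : simpl never.

Lemma copy_class s w :
  copy s (free_class w) = pres_class rel [seq (copy_letter s x.1, x.2) | x <- w].
Proof.
rewrite -word_eval_pres_gen word_eval_map /copy; case: s.
  by rewrite /double_inr free_lift_map free_lift_class.
by rewrite /double_inl free_lift_class.
Qed.

Lemma copyM s : {morph copy s : x y / x * y}.
Proof.
move=> x y; rewrite -[x]free_classK -[y]free_classK -free_class_cat.
by rewrite !copy_class map_cat pres_class_cat.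
Qed.

Lemma copy_cyclic_gen : copy false u = copy true u.
Proof.
rewrite -[u in LHS]free_classK -[u in RHS]free_classK !copy_class.
apply/pres_classP/word_cong_rel; split.
  by rewrite -free_map_class free_classK.
rewrite -[u in RHS]free_classK !free_map_class -map_comp.
by congr free_class; apply: eq_map.
Qed.

Definition letter_side (t : A + A') : bool := if t is inr _ then true else false.
Definition letter_base (t : A + A') : A :=
  match t with inl a => a | inr a' => psi a' end.

Lemma copy_letterK t : copy_letter (letter_side t) (letter_base t) = t.
Proof. by case: t => //= a'; rewrite psiK. Qed.

Definition retract : G -> FA := pres_lift (fun t => free_gen (letter_base t)).

Lemma retract_rel v1 v2 : rel v1 v2 ->
  word_eval (fun t => free_gen (letter_base t)) v1 =
  word_eval (fun t => free_gen (letter_base t)) v2.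
Proof.
case; rewrite -!free_lift_class => -> ->; rewrite !free_lift_map.
by congr free_lift; apply/funext => a /=; rewrite phiK.
Qed.

Lemma retractM : {morph retract : x y / x * y}.
Proof. exact: pres_liftM retract_rel. Qed.

Lemma retract_class w : retract (pres_class rel w) =
  free_class [seq (letter_base x.1, x.2) | x <- w].
Proof.
rewrite /retract pres_lift_class; last exact: retract_rel.
by rewrite -[RHS](word_eval_pres_gen (@no_relation A)) word_eval_map.
Qed.

Lemma retract_copy s x : retract (copy s x) = x.
Proof.
rewrite -[x in LHS]free_classK copy_class retract_class -map_comp.
rewrite -[RHS]free_classK; congr free_class; rewrite -[RHS]map_id.
by apply: eq_map => -[a b] /=; case: s => //=; rewrite phiK.
Qed.

(** The subgroup <u>, presented as a submonoid with two generators so that the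
    search for factorizations applies to it. *)
Definition cyclic_sub : set FA := submonoid_gen [fset u; u^-1]%fset.

Lemma cyclic_sub1 : cyclic_sub 1.
Proof. by exists [::]; split=> //; rewrite big_nil. Qed.

Lemma cyclic_subM x y : cyclic_sub x -> cyclic_sub y -> cyclic_sub (x * y).
Proof.
move=> [s [sS <-]] [t [tS <-]]; exists (s ++ t); split; last by rewrite big_cat.
by move=> z; rewrite mem_cat => /orP[/sS|/tS].
Qed.

Lemma cyclic_subV x : cyclic_sub x -> cyclic_sub x^-1.
Proof.
case=> s [sS <-]; elim: s sS => [|y s IHs] sS.
  by rewrite big_nil invg1; exact: cyclic_sub1.
rewrite big_cons invgM; apply: cyclic_subM.
  by apply: IHs => z zs; apply: sS; rewrite inE zs orbT.
exists [:: y^-1]; split; last by rewrite big_seq1.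
move=> z; rewrite inE => /eqP->; have := sS y (mem_head _ _).
by rewrite !inE => /orP[]/eqP->; rewrite ?invgK eqxx ?orbT.
Qed.

Lemma cyclic_sub_gen : cyclic_sub u.
Proof.
exists [:: u]; split; last by rewrite big_seq1.
by move=> z; rewrite !inE => ->.
Qed.

Lemma copy_cyclic_sub x s s' : cyclic_sub x -> copy s x = copy s' x.
Proof.
suff H : cyclic_sub x -> copy false x = copy true x.
  by move=> /H e; case: s; case: s'.
case=> t [tS <-]; rewrite !(morph_prod (copyM _)).
elim: t tS => // y t IHt tS; rewrite !map_cons !big_cons IHt; last first.
  by move=> z zt; apply: tS; rewrite inE zt orbT.
congr (_ * _); have := tS y (mem_head _ _); rewrite !inE => /orP[]/eqP->.
  exact: copy_cyclic_gen.
by rewrite !(morphV (copyM _)) copy_cyclic_gen.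
Qed.

Local Notation state := (FA * seq (bool * FA))%type.
Local Notation normal := (normal cyclic_sub).
Local Notation side_act := (side_act cyclic_sub).

Let act_normal := @side_act_normal _ _ cyclic_sub1 cyclic_subM cyclic_subV.
Let actM := @side_actM _ cyclic_sub.
Let act1 := @side_act1 _ _ cyclic_sub1 cyclic_subM cyclic_subV.
Let act_base := @side_act_base _ _ cyclic_sub1 cyclic_subM cyclic_subV.
Let act_push := @side_act_push _ _ cyclic_sub1 cyclic_subM cyclic_subV.

(** The action of the double on normal forms is first defined for words; the
    defining relation u = u' preserves it because u lies in the subgroup on which
    the two actions agree. *)
Definition word_act (w : word (A + A')) (p : state) : state :=
  foldr (fun x => side_act (letter_side x.1)
                    (free_class [:: (letter_base x.1, x.2)])) p w.

Lemma word_act_cat v w p : word_act (v ++ w) p = word_act v (word_act w p).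
Proof. exact: foldr_cat. Qed.

Lemma word_act_normal w p : normal p -> normal (word_act w p).
Proof. by move=> np; elim: w => //= x w; exact: act_normal. Qed.

Lemma word_act_cong (R : word (A + A') -> word (A + A') -> Prop) v w :
  (forall v w p, R v w -> normal p -> word_act v p = word_act w p) ->
  word_cong R v w -> forall p, normal p -> word_act v p = word_act w p.
Proof.
move=> hR; elim=> //.
- by move=> v1 v2 _ IH p np; rewrite IH.
- by move=> v1 v2 v3 _ IH12 _ IH23 p np; rewrite IH12 ?IH23.
- move=> v1 v2 v3 v4 _ IH12 _ IH34 p np.
  by rewrite !word_act_cat IH34 // IH12 //; exact: word_act_normal.
- move=> t b p np /=; rewrite actM // -free_class_cat /=.
  have -> : free_class [:: (letter_base t, b); (letter_base t, ~~ b)] = 1.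
    exact/pres_classP/word_cong_cancel.
  exact: act1.
- by move=> v1 v2 Rv p; exact: hR.
Qed.

Lemma word_act_copy s w p : normal p ->
  word_act [seq (copy_letter s x.1, x.2) | x <- w] p =
  side_act s (free_class w) p.
Proof.
move=> np; elim: w => [|[a b] w IHw] /=; first by rewrite act1.
have -> : letter_side (copy_letter s a) = s by case: s {IHw}.
have -> : letter_base (copy_letter s a) = a by case: s {IHw} => //=; rewrite phiK.
by rewrite IHw actM // -free_class_cat.
Qed.

Lemma word_act_free v w p : free_class v = free_class w -> normal p ->
  word_act v p = word_act w p.
Proof. by move=> /pres_classP vw; apply: word_act_cong vw _. Qed.

Lemma word_act_rel v w p : rel v w -> normal p -> word_act v p = word_act w p.
Proof.
move=> [ev ew] np.
have copyE s : free_map (copy_letter s) u =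
    free_class [seq (copy_letter s x.1, x.2) | x <- repr u].
  by rewrite -free_map_class free_classK.
rewrite (@word_act_free v
  [seq (copy_letter false x.1, x.2) | x <- repr u]) //; last first.
  by rewrite ev -copyE.
rewrite (@word_act_free w
  [seq (copy_letter true x.1, x.2) | x <- repr u]) //; last first.
  rewrite ew -copyE -[u]free_classK !free_map_class -map_comp.
  by congr free_class; apply: eq_map.
rewrite !word_act_copy // free_classK.
by rewrite !act_base //; exact: cyclic_sub_gen.
Qed.

Definition group_act (g : G) : state -> state := word_act (repr g).

Lemma group_act_class w p : normal p ->
  group_act (pres_class rel w) p = word_act w p.
Proof.
exact: word_act_cong word_act_rel (word_cong_repr rel w) p.
Qed.

Lemma group_actM g h p : normal p ->
  group_act (g * h) p = group_act g (group_act h p).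
Proof.
move=> np; rewrite -[g in LHS]pres_classK -[h in LHS]pres_classK -pres_class_cat.
by rewrite group_act_class // word_act_cat.
Qed.

Lemma group_act_copy s x p : normal p ->
  group_act (copy s x) p = side_act s x p.
Proof.
move=> np; rewrite -[x in LHS]free_classK copy_class group_act_class //.
by rewrite word_act_copy // free_classK.
Qed.

Fixpoint alternating_prod (s : bool) (l : seq FA) : G :=
  if l is x :: l' then copy s x * alternating_prod (~~ s) l' else 1.

(** A syllable outside <u> always adds an entry to a normal form that starts in
    the other copy, so that the syllables can be counted from the result. *)
Lemma group_act_alternating s l : (forall x, x \in l -> ~ cyclic_sub x) ->
  exists2 p, group_act (alternating_prod s l) (1, [::]) = p &
    [/\ normal p, size p.2 = size l & starts_off (~~ s) p.2].
Proof.
have n0 : normal (1, [::]) by split=> //; exact: cyclic_sub1.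
elim: l s => [|x l IHl] s nl.
  by exists (1, [::]) => //; rewrite (group_act_class [::]).
have [|p ep [np sp op]] := IHl (~~ s).
  by move=> y yl; apply: nl; rewrite inE yl orbT.
rewrite negbK in op.
have [h [c e]] := act_push (nl x (mem_head _ _)) np op.
exists (h, (s, c) :: p.2); last first.
  by split; [rewrite -e; exact: act_normal | rewrite /= sp | rewrite /=; case: (s)].
by rewrite /= group_actM // ep group_act_copy.
Qed.

(** The first syllable x may lie in <u>: it then leaves the list of the normal
    form unchanged, and otherwise it lengthens the list. *)
Theorem alternating_prod_neq1 s x l : (forall y, y \in l -> ~ cyclic_sub y) ->
  alternating_prod s (x :: l) = 1 -> l = [::].
Proof.
move=> nl e; have n0 : normal (1, [::]) by split=> //; exact: cyclic_sub1.
have [p ep [np sp op]] := group_act_alternating (~~ s) nl; rewrite negbK in op.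
apply: size0nil; have : group_act 1 (1, [::]) = (1, [::]).
  exact: (group_act_class [::]).
rewrite -e /= group_actM // ep group_act_copy //.
have [Hx|nHx] := pselect (cyclic_sub x).
  by rewrite act_base // => -[_ e2]; rewrite -sp e2.
by have [h [c ->]] := act_push nHx np op.
Qed.

Section StackMachine.
Variable in_cyclic : word A -> bool.
Hypothesis in_cyclicP : forall w, reflect (cyclic_sub (free_class w)) (in_cyclic w).

Definition stack := (bool * (word A * seq (word A)))%type.

(** A stack (s, (top, rest)) stands for the product of the syllables top :: rest,
    which belong alternately to the two copies, starting with the copy s; only
    the top syllable may lie in <u>.  When a letter of the other copy arrives
    and the top lies in <u>, the top also belongs to that other copy, as does the
    next syllable of the stack if there is one, and all are merged.  The merged
    syllable becomes the new top, so that it may again lie in <u>. *)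
Definition stack_step (x : (A + A') * bool) (st : stack) : stack :=
  let s := letter_side x.1 in
  let y := (letter_base x.1, x.2) in
  if s == st.1 then (s, (y :: st.2.1, st.2.2)) else
  if in_cyclic st.2.1 then
    (s, (y :: st.2.1 ++ head [::] st.2.2, behead st.2.2))
  else (s, ([:: y], st.2.1 :: st.2.2)).

Definition run_stack (w : word (A + A')) : stack :=
  foldr stack_step (false, ([::], [::])) w.

Definition stack_value (st : stack) : G :=
  alternating_prod st.1 (map (@free_class A) (st.2.1 :: st.2.2)).

Lemma stack_step_value x st :
  stack_value (stack_step x st) = pres_class rel [:: x] * stack_value st.
Proof.
have ex : pres_class rel [:: x] =
    copy (letter_side x.1) (free_class [:: (letter_base x.1, x.2)]).
  by rewrite copy_class /= copy_letterK -surjective_pairing.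
case: st => s [top rest]; rewrite /stack_step /stack_value ex /=.
case: eqP => [->|ne] /=; first by rewrite free_class_cons copyM mulgA.
have {}ne : s = ~~ letter_side x.1 by case: (s) (letter_side _) ne => -[].
case: in_cyclicP => [Ht|_] /=; last by rewrite ne.
rewrite free_class_cons free_class_cat !copyM -!mulgA; congr (_ * _).
rewrite (copy_cyclic_sub _ s Ht); congr (_ * _); rewrite ne negbK.
case: rest => [|v rest] //=.
by rewrite (_ : free_class [::] = 1) // (morph1 (copyM _)) mulg1.
Qed.

Lemma run_stack_value w : stack_value (run_stack w) = pres_class rel w.
Proof.
elim: w => [|x w IHw].
  by rewrite /stack_value /= mulg1; exact: (copy_class false [::]).
by rewrite /= stack_step_value IHw -pres_class_cat.
Qed.

Lemma run_stack_rest w : all (predC in_cyclic) (run_stack w).2.2.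
Proof.
elim: w => //= x w; rewrite /stack_step; case: ifP => // _.
by case: ifP => [_|/= ->] //; case: (run_stack w).2.2 => //= v r /andP[].
Qed.

Lemma run_stackP w :
  reflect (pres_class rel w = 1)
    (((run_stack w).2.2 == [::]) && (reduce (run_stack w).2.1 == [::])).
Proof.
have := run_stack_value w; have := run_stack_rest w; rewrite /stack_value.
case: (run_stack w) => s [top rest] /= nr <-.
apply: (iffP andP) => [[/eqP-> /eqP e] /=|e].
  rewrite mulg1 -free_class_reduce e; exact: morph1 (copyM s).
have r0 : rest = [::].
  apply: size0nil; rewrite -(size_map (@free_class A)).
  rewrite (@alternating_prod_neq1 s (free_class top) _ _ e) // => y.
  by move=> /mapP[v /(allP nr)/= nv ->] /in_cyclicP; rewrite (negbTE nv).
split; first by rewrite r0.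
move: e; rewrite r0 /= mulg1 => /(congr1 retract).
rewrite retract_copy (morph1 retractM) => e.
by rewrite -normal_word_class e (normal_word_class [::]).
Qed.

End StackMachine.
End Double.

Lemma prodg_nseq (G : monoidType) n (x : G) : \prod_(y <- nseq n x) y = x ^+ n.
Proof. by elim: n => [|n IHn]; rewrite ?big_nil // big_cons IHn expgS. Qed.

Lemma expg_mod (G : groupType) (x : G) N n : x ^+ N = 1 -> x ^+ n = x ^+ (n %% N).
Proof.
by move=> xN; rewrite {1}(divn_eq n N) expgnDr mulnC expgnA xN expg1n mul1g.
Qed.

(** * Deciding membership by bounded search *)
Section CyclicBound.
Variables (A : finType) (u : free_group A).

Lemma cyclic_sub_power x : cyclic_sub u x -> exists n, x = u ^+ n \/ x = u^-1 ^+ n.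
Proof.
case=> s [sS <-]; elim: s sS => [|y s IHs] sS.
  by exists 0; left; rewrite big_nil.
rewrite big_cons; have [|n IHn] := IHs.
  by move=> z zs; apply: sS; rewrite inE zs orbT.
have := sS y (mem_head _ _); rewrite !inE => /orP[]/eqP->; case: IHn => ->.
- by exists n.+1; left; rewrite expgS.
- case: n => [|n]; first by exists 1%N; left; rewrite mulg1.
  by exists n; right; rewrite expgS mulVKg.
- case: n => [|n]; first by exists 1%N; right; rewrite mulg1.
  by exists n; left; rewrite expgS mulKg.
- by exists n.+1; right; rewrite expgS.
Qed.

(** If u has infinite order, then each element is at most one power of u and the
    linear estimate applies to the set {u}; the length of u^-n is that of u^n.
    If u has finite order N, exponents below N suffice; treating this case,
    even if it is vacuous for u <> 1, avoids an appeal to torsion-freeness. *)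
Lemma linear_cyclic_sub : exists C, forall x, cyclic_sub u x ->
  exists2 s, words_for [fset u; u^-1]%fset x s & size s <= C * (flen x).+1.
Proof.
have mk n v : v \in [fset u; u^-1]%fset ->
    words_for [fset u; u^-1]%fset (v ^+ n) (nseq n v).
  by move=> vS; split; [move=> y /nseqP[-> _] | rewrite prodg_nseq].
have uS : u \in [fset u; u^-1]%fset by rewrite !inE eqxx.
have VS : u^-1 \in [fset u; u^-1]%fset by rewrite !inE eqxx orbT.
have [[N N0 uN]|noN] := pselect (exists2 N, 0 < N & u ^+ N = 1).
  exists N => x /cyclic_sub_power[n en].
  have vN : u^-1 ^+ N = 1 by rewrite expVgn uN invg1.
  have le : n %% N <= N * (flen x).+1.
    by apply: leq_trans (ltnW (ltn_pmod n N0)) _; rewrite leq_pmulr.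
  case: en le => ->; rewrite (expg_mod n uN, expg_mod n vN) => le.
    by exists (nseq (n %% N) u); [exact: mk | rewrite size_nseq].
  by exists (nseq (n %% N) u^-1); [exact: mk | rewrite size_nseq].
have inj a b : u ^+ a = u ^+ b -> a <= b.
  move=> e; rewrite leqNgt; apply/negP => lt_ba; apply: noN.
  by exists (a - b)%N; rewrite ?subn_gt0 // expgnFr 1?ltnW // e mulgV.
have hX : bounded_factorizations [fset u]%fset.
  move=> m; have power s : words_for [fset u]%fset m s -> m = u ^+ size s.
    case=> sX <-; rewrite -prodg_nseq; congr bigop.
    by apply/all_pred1P/allP => y /sX; rewrite inE.
  have [[s /power es]|none] := pselect (exists s, words_for [fset u]%fset m s).
    by exists (size s) => t /power; rewrite es => /esym/inj.
  by exists 0 => s ms; case: none; exists s.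
have [C hC] := linear_factorizations hX.
have hn n : n <= C * (flen (u ^+ n)).+1.
  rewrite -{1}(size_nseq n u) -prodg_nseq; apply: hC => y /nseqP[-> _].
  by rewrite inE.
exists C => x /cyclic_sub_power[n [->|->]].
  by exists (nseq n u); [exact: mk | rewrite size_nseq].
exists (nseq n u^-1); first exact: mk.
rewrite size_nseq; apply: leq_trans (hn n) _.
by rewrite leq_mul2l ltnS -{1}[u ^+ n]invgK -expVgn flenV orbT.
Qed.

End CyclicBound.

Section Search.
Variables (T : finType) (R : word T -> word T -> Prop).
Variable trivial_word : word T -> bool.
Hypothesis trivialP : forall w, reflect (pres_class R w = 1) (trivial_word w).
Hypothesis trivial_computable : computable trivial_word.

Definition concatenations (gens : seq (word T)) (n : nat) : seq (word T) :=
  iter n (fun l => l ++ [seq g ++ v | g <- gens, v <- l]) [:: [::]].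

Lemma concatenations_sound gens n p : p \in concatenations gens n ->
  exists2 s, {subset s <= gens} & p = flatten s.
Proof.
elim: n p => [|n IHn] p; first by rewrite inE => /eqP->; exists [::].
rewrite /= mem_cat => /orP[/IHn//|/allpairsP[[g v] [/= gG /IHn[s sG ->] ->]]].
by exists (g :: s) => // y; rewrite inE => /predU1P[->|/sG].
Qed.

Lemma concatenations_complete gens n s : {subset s <= gens} -> size s <= n ->
  flatten s \in concatenations gens n.
Proof.
elim: n s => [|n IHn] [|g s] sG //= le_sn; rewrite mem_cat.
  by apply/orP; left; exact: (IHn [::]).
apply/orP; right; apply/allpairsP; exists (g, flatten s).
split=> //; first by apply: sG; rewrite mem_head.
by apply: IHn => // y ys; apply: sG; rewrite inE ys orbT.
Qed.

Lemma computable_concatenations (U : countType) gens (n : U -> nat) :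
  computable n -> computable (fun x => concatenations gens (n x)).
Proof.
move=> hn; apply: (computable_iter
  (s := fun _ l => l ++ [seq g ++ v | g <- gens, v <- l])) => //; last first.
  exact: computable_const.
have h2 := computable_snd (computable_id (U * seq (word T))%type).
apply: computable_cat => //; elim: gens => [|g gens IHg] /=.
  exact: computable_const.
apply: computable_cat => //.
apply: (computable_map (f := fun _ v => g ++ v)) => //.
apply: computable_cat; first exact: computable_const.
exact: computable_snd (computable_id _).
Qed.

Variables (S : {fset presented R}) (C : nat).
Hypothesis short_factorization : forall w, submonoid_gen S (pres_class R w) ->
  exists2 s, words_for S (pres_class R w) s & size s <= C * (size w).+1.

Let gen_words := [seq inv_word (repr y) | y <- S].

Let gen_wordsE (s : seq (presented R)) :
  pres_class R (flatten [seq inv_word (repr y) | y <- s]) =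
  (\prod_(y <- rev s) y)^-1.
Proof.
elim: s => [|y s IHs]; first by rewrite big_nil invg1.
rewrite /= pres_class_cat IHs pres_class_inv pres_classK.
by rewrite rev_cons -cats1 big_cat big_seq1 invgM.
Qed.

(** An element w lies in the submonoid generated by S when w becomes trivial after
    left multiplication by a product of inverses of elements of S.  The length of
    the product can be bounded in terms of w, so that finitely many calls to the
    word problem decide. *)
Theorem computable_membership :
  computable (fun w : word T => `[< submonoid_gen S (pres_class R w) >]).
Proof.
have h : computable (fun w : word T => has (fun p => trivial_word (p ++ w))
    (concatenations gen_words (C * (size w).+1))).
  apply: (computable_has (p := fun w p => trivial_word (p ++ w))).
    apply: (computable_comp trivial_computable).
    apply: computable_cat; first exact: computable_snd (computable_id _).
    exact: computable_fst (computable_id _).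
  apply: computable_concatenations; apply: (computable_unary (unary_rec_mul C)).
  apply: (computable_unary unary_rec_succ); apply: computable_size.
  exact: computable_id.
apply: computable_ext h => w; apply/hasP/asboolP => [[p]|].
  move=> /concatenations_sound[t tG ->] /trivialP.
  have [s sS ->] : exists2 s : seq (presented R), {subset s <= S} &
      t = [seq inv_word (repr y) | y <- s].
    elim: t tG => [|v t IHt] tG; first by exists [::].
    have [|s sS ->] := IHt.
      by move=> z zt; apply: tG; rewrite inE zt orbT.
    have /mapP[y yS ->] := tG v (mem_head _ _).
    by exists (y :: s) => // z; rewrite inE => /predU1P[->|/sS].
  rewrite pres_class_cat gen_wordsE => e.
  exists (rev s); split; first by move=> y; rewrite mem_rev => /sS.
  by apply: (mulgI (\prod_(y <- rev s) y)^-1); rewrite mulVg e.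
move=> /short_factorization[s [sS es] le_s].
exists (flatten [seq inv_word (repr y) | y <- rev s]).
  apply: concatenations_complete; last by rewrite size_map size_rev.
  move=> v /mapP[y]; rewrite mem_rev => /sS yS ->.
  by apply/mapP; exists y.
by apply/trivialP; rewrite pres_class_cat gen_wordsE revK es mulVg.
Qed.

End Search.

Section WordProblems.

(** A letter differs from its inverse, so that the letter itself can serve as the
    default value of the head when the word is empty. *)
Lemma computable_reduce (T : finType) (U : countType) (w : U -> word T) :
  computable w -> computable (fun x => reduce (w x)).
Proof.
move=> hw; apply: (computable_foldr (s := fun _ => @push T)) => //; last first.
  exact: computable_const.
have h2 := computable_snd (computable_id (U * ((T * bool) * word T))%type).
have h21 := computable_fst h2; have h22 := computable_snd h2.
have h : computable (fun q : U * ((T * bool) * word T) =>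
    if head q.2.1 q.2.2 == flip q.2.1 then behead q.2.2 else q.2.1 :: q.2.2).
  apply: computable_if; last 2 first.
  - exact: computable_behead.
  - exact: computable_cons.
  apply: computable_eq; first exact: computable_head.
  exact: (computable_fin (@flip T)).
apply: computable_ext h => -[x [y [|z s]]] //=.
by rewrite /flip; case: y => t [] /=; rewrite xpair_eqE andbF.
Qed.

Variables (A A' : finType) (phi : A -> A') (psi : A' -> A) (u : free_group A).
Hypotheses (phiK : cancel phi psi) (psiK : cancel psi phi).

Lemma computable_cyclic_sub :
  computable (fun w : word A => `[< cyclic_sub u (free_class w) >]).
Proof.
have [C hC] := linear_cyclic_sub u.
apply: (@computable_membership A _ (fun w => reduce w == [::]) _ _ _ C).
- move=> w; apply: (iffP eqP) => [e|/pres_classP].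
    by rewrite -[LHS]free_class_reduce e.
  by move=> /foldr_push_cong; apply.
- apply: computable_eq; last exact: computable_const.
  exact/computable_reduce/computable_id.
- move=> w /hC[s ws le_s]; exists s => //; apply: leq_trans le_s _.
  by rewrite leq_mul2l ltnS flen_class orbT.
Qed.

Let in_cyclic w := `[< cyclic_sub u (free_class w) >].

Lemma computable_run_stack :
  computable (run_stack (A' := A') psi in_cyclic).
Proof.
pose L := ((A + A') * bool)%type.
apply: (computable_foldr (T := word (A + A')) (E := L) (U := stack A)
  (s := fun _ x st => stack_step psi in_cyclic x st)
  (a := fun=> (false, ([::], [::]))) (l := id)); last 2 first.
- exact: computable_const.
- exact: computable_id.
have hx := computable_fst (computable_snd
  (computable_id (word (A + A') * (L * stack A))%type)).
have hst := computable_snd (computable_snd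
  (computable_id (word (A + A') * (L * stack A))%type)).
have hs : computable (fun q : word (A + A') * (L * stack A) =>
    letter_side q.2.1.1).
  exact: (computable_fin (fun x : L => letter_side x.1)).
have hy : computable (fun q : word (A + A') * (L * stack A) =>
    (letter_base psi q.2.1.1, q.2.1.2)).
  exact: (computable_fin (fun x : L => (letter_base psi x.1, x.2))).
have htop := computable_fst (computable_snd hst).
have hrest := computable_snd (computable_snd hst).
apply: computable_if.
- by apply: computable_eq => //; exact: computable_fst.
- apply: computable_pair => //; apply: computable_pair => //.
  exact: computable_cons.
- apply: computable_if.
  + exact: (computable_comp computable_cyclic_sub).
  + apply: computable_pair => //; apply: computable_pair.
      apply: computable_cons => //; apply: computable_cat => //.
      by apply: computable_head => //; exact: computable_const.
    exact: computable_behead.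
  + apply: computable_pair => //; apply: computable_pair.
      by apply: computable_cons => //; exact: computable_const.
    exact: computable_cons.
Qed.

Lemma computable_trivial_word :
  computable (fun w => ((run_stack (A' := A') psi in_cyclic w).2.2 == [::]) &&
    (reduce (run_stack psi in_cyclic w).2.1 == [::])).
Proof.
have h2 := computable_snd computable_run_stack.
apply: (computable_if (g := fun=> false)); last exact: computable_const.
  apply: computable_eq; last exact: computable_const.
  exact: computable_snd.
apply: computable_eq; last exact: computable_const.
exact/computable_reduce/computable_fst.
Qed.

End WordProblems.

Theorem theorem6p17 (A A' : finType) (phi : A -> A') (u : free_group A)
    (X : {fset free_group A}) :
  bijective phi ->
  (1%g \notin X)%fset ->
  graded (submonoid_gen X) ->
  let G := double_group phi u in
  let M := submonoid_gen (double_gens phi u X) in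
  [/\ graded M,
      forall S X0 : {fset G},
        submonoid_gen S = M -> submonoid_gen X0 = setT ->
        exists2 delta, distortion_function M S X0 delta & linearly_bounded delta
    & membership_decidable (double_gen phi u) M].
Proof.
move=> [psi phiK psiK] X1 gX G M.
have hX := graded_bounded X1 gX.
have rM := @retractM _ _ _ _ u phiK.
have rX y : y \in double_gens phi u X -> retract psi y \in X.
  rewrite /double_gens inE => /orP[]/imfsetP[x /= xX ->].
    by have /= -> := retract_copy u phiK false x.
  by have /= -> := retract_copy u phiK true x.
split.
- exact: bounded_graded (bounded_pullback rM rX hX).
- exact: linear_distortion rM rX hX.
apply: computable_decidable.
have [C hC] := linear_pullback rM rX hX.
suff h : computable (fun w : word (A + A') =>
    `[< M (pres_class (double_relation phi u) w) >]).
  by apply: computable_ext h => w; rewrite [word_eval _ _]word_eval_pres_gen.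
refine (@computable_membership _ (double_relation phi u) _ _
  (computable_trivial_word psi u) (double_gens phi u X) C _).
  move=> w; apply: run_stackP => // v; exact: asboolP.
move=> w [s ms]; exists s => //; apply: leq_trans (hC _ _ ms) _.
rewrite leq_mul2l ltnS retract_class //.
by rewrite (leq_trans (flen_class _)) ?orbT // size_map.
Qed.
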